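(* Let $G=(V,E,F)$ be a connected infinite penny graph such that $\sup_{\sigma\in F}\deg(\sigma)<\infty$. Then the metric spaces $(V,d_V)$ and $(\mathbb{Z}^2,d_{\mathbb{Z}^2})$ are quasi-isometric.
   Context: Penny graphs: Let $\{B_i\}_{i=1}^\infty$ be a collection of pairwise disjoint open disks of radius $\frac12$ in $\mathbb{R}^2$, with boundary circles $C_i$ and centers $c_i$. Let $V=\{v_i\}_{i=1}^\infty$, and let $\{v_i,v_j\}\in E$ ($i\ne j$) iff $C_i$ and $C_j$ are tangent, i.e. $|c_i-c_j|=1$. The embedding $\phi$ is given by $\phi(v_i)=c_i$, $\phi(\{v_i,v_j\})=\overline{c_ic_j}$ (the straight segment). The set $F$ of faces corresponds to the connected components of the complement in $\mathbb{R}^2$ of the embedded image of $(V,E)$; for $\sigma\in F$, $\phi(\sigma)$ denotes the corresponding component. The facial degree $\deg(\sigma)\in\mathbb{N}\cup\{\infty\}$ is the number of interior angles (corners at embedded vertices, counted with multiplicity) of the polygonal domain $\phi(\sigma)$. The triple $G=(V,E,F)$ is called an infinite penny graph; it is connected if the graph $(V,E)$ is connected. $d_V$ is the combinatorial (shortest path) distance on the graph $(V,E)$. $\mathbb{Z}^2$ is the integer lattice graph with $w,z\in\mathbb{Z}^2$ adjacent iff $|w-z|=1$, and $d_{\mathbb{Z}^2}$ is its combinatorial distance. Two metric spaces $(X,d_X)$, $(Y,d_Y)$ are quasi-isometric if there are a map $\psi:X\to Y$ and constants $a\ge1$, $C>0$ such that (a) $a^{-1}d_X(x_1,x_2)-C\le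 d_Y(\psi(x_1),\psi(x_2))\le a\,d_X(x_1,x_2)+C$ for all $x_1,x_2\in X$, and (b) for every $y\in Y$ there is $x\in X$ with $d_Y(y,\psi(x))<C$. *)

(* Defs.v *)
From HB Require Import structures.
From mathcomp Require Import all_boot all_order all_algebra.
From mathcomp Require Import all_classical all_reals all_analysis.

Set Implicit Arguments.
Unset Strict Implicit.
Unset Printing Implicit Defensive.

Import Order.TTheory GRing.Theory Num.Theory numFieldNormedType.Exports.
Local Open Scope classical_set_scope.
Local Open Scope ring_scope.

Section Graphs.
Variables (T : eqType) (e : rel T).

Definition walk (x y : T) (n : nat) : Prop :=
  exists p : seq T, [/\ path e x p, last x p = y & size p = n].

Definition connected_graph : Prop := forall x y : T, exists n, walk x y n.

Lemma ex_walkb (x y : T) : (exists n, walk x y n) -> exists n, `[< walk x y n >].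
Proof. by case=> n w; exists n; apply/asboolP. Qed.

(* Shortest-path distance. The value 0 for vertices in different components is
   a junk value, never used when the graph is connected. *)
Definition graph_dist (x y : T) : nat :=
  if pselect (exists n, walk x y n) is left w then ex_minn (ex_walkb w) else 0%N.

End Graphs.

Definition quasi_isometric (R : realType) (X Y : Type)
    (dX : X -> X -> R) (dY : Y -> Y -> R) : Prop :=
  exists (psi : X -> Y) (a C : R),
    [/\ 1 <= a, 0 < C,
        forall x1 x2 : X, a^-1 * dX x1 x2 - C <= dY (psi x1) (psi x2)
                          /\ dY (psi x1) (psi x2) <= a * dX x1 x2 + C
      & forall y : Y, exists x : X, dY y (psi x) < C].

Section Plane.
Variable R : realType.

(* The product carries the usual topology of R^2, but the library norm on it is
   the sup norm; hence the explicit Euclidean distance. *)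
Definition plane : Type := (R * R)%type.

Definition edist (p q : plane) : R :=
  Num.sqrt ((p.1 - q.1) ^+ 2 + (p.2 - q.2) ^+ 2).

Definition disk (p : plane) (r : R) : set (R * R) := [set q | edist p q < r].

Definition segment (p q : plane) : set (R * R) :=
  [set ((1 - t) * p.1 + t * q.1, (1 - t) * p.2 + t * q.2) | t in `[0, 1]].

Definition unit_distance (T : Type) (c : T -> plane) : rel T :=
  [rel i j | edist (c i) (c j) == 1].

Definition lattice_point (w : int * int) : plane := (w.1%:~R, w.2%:~R).

Definition components (A : set (R * R)) : set (set (R * R)) :=
  [set connected_component A x | x in A].

Section PennyGraph.
Variable c : nat -> plane.

Definition penny_packing : Prop :=
  trivIset setT (fun i => disk (c i) 2^-1).

Definition penny_embedding : set (R * R) :=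
  range c `|`
  [set x | exists i j, unit_distance c i j /\ segment (c i) (c j) x].

Definition penny_faces : set (set (R * R)) := components (~` penny_embedding).

(* The open disk of radius 1/2 about c i meets the embedded graph only in radii
   along the edges at vertex i (any other edge is at distance at least
   sqrt 3 / 2 from c i). So its traces in a face s are open sectors, one for
   each interior angle of s at vertex i; a face meeting the same vertex in
   several sectors gets one corner per sector. *)
Definition corners (s : set (R * R)) : set (nat * set (R * R)) :=
  [set iS | components (s `&` disk (c iS.1) 2^-1) iS.2].

Definition face_degree (s : set (R * R)) : \bar R := @counting _ R (corners s).

End PennyGraph.
End Plane.

(* Main.v *)
(* Round the centres to integer points: distances in the graph dominate
   Euclidean ones, so everything rests on two facts, that the vertices are
   coarsely dense and that vertices at bounded Euclidean distance are at bounded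
   graph distance.

   Turning left at each vertex permutes the darts (oriented edges); the face on
   the left of a dart is constant along an orbit, so bounded facial degree bounds
   the orbits, which are thus closed walks of bounded length. Let B be a finite
   union of orbits and w its winding number. Crossing an edge {d, d'} changes w
   by [d in B] - [d' in B], hence w(left of d) - [d in B] is invariant under
   turning left and under reversing darts. As the graph is connected, it is the
   same for all darts, and it is 0 far away. So w is the indicator function of
   the faces of B: two darts with the same left face lie in the same orbit, and
   every point of a face is close to its orbit, which gives the first fact.

   For the second, move along the segment between two vertices. The faces near
   a given point of the plane are either one face, or those at one vertex, or
   the two sides of one edge, so their boundary vertices are joined by bounded
   walks. Since the segment is connected, its endpoints are joined inside a box
   of bounded size, which contains a bounded number of vertices. *)

Require Import Defs.
From mathcomp Require Import all_boot all_order all_algebra.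
From mathcomp Require Import all_classical all_reals all_analysis.
From mathcomp Require Import ring lra zify.
Set Implicit Arguments.
Unset Strict Implicit.
Unset Printing Implicit Defensive.
Import Order.TTheory GRing.Theory Num.Theory numFieldNormedType.Exports.
Local Open Scope classical_set_scope.
Local Open Scope ring_scope.

(** * Squared Euclidean distances between points and unit segments *)

Section SquaredDistance.
Variable R : realType.
Implicit Types p q a b x : (R * R)%type.

Definition dsq p q : R := (p.1 - q.1) ^+ 2 + (p.2 - q.2) ^+ 2.

Lemma dsq_ge0 p q : 0 <= dsq p q.
Proof. by rewrite addr_ge0 ?sqr_ge0. Qed.

Lemma dsqC p q : dsq p q = dsq q p.
Proof. by rewrite /dsq; ring. Qed.

Lemma dsqpp p : dsq p p = 0.
Proof. by rewrite /dsq !subrr; ring. Qed.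

Lemma edist_eq1 p q : (Defs.edist p q == 1) = (dsq p q == 1).
Proof.
rewrite /Defs.edist -/(dsq p q) -[in RHS](sqr_sqrtr (dsq_ge0 p q)).
by rewrite sqrp_eq1 // sqrtr_ge0.
Qed.

Lemma edist_lt p q (r : R) : 0 < r -> (Defs.edist p q < r) = (dsq p q < r ^+ 2).
Proof.
move=> r0; rewrite /Defs.edist -/(dsq p q) -[in RHS](sqr_sqrtr (dsq_ge0 p q)).
by rewrite ltr_pXn2r // ?nnegrE ?sqrtr_ge0 // ltW.
Qed.

(** Stewart's theorem. The separation constants 3/4 and 3/16 below come from it. *)
Lemma dsq_segment p a b (t : R) :
  dsq p ((1 - t) * a.1 + t * b.1, (1 - t) * a.2 + t * b.2) =
  (1 - t) * dsq p a + t * dsq p b - t * (1 - t) * dsq a b.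
Proof. by rewrite /dsq /=; ring. Qed.

(** By Stewart's theorem the squared distance is at least 1 - t (1 - t); the extremal case is the
    height of a unit equilateral triangle. *)
Lemma edge_away p a b x : dsq a b = 1 -> 1 <= dsq p a -> 1 <= dsq p b ->
  segment a b x -> 3 / 4 <= dsq p x.
Proof.
move=> ab pa pb [t /=]; rewrite in_itv /= => /andP[t0 t1] <-.
rewrite dsq_segment ab; have := sqr_ge0 (t - 1 / 2); nra.
Qed.

Definition midp a b : R * R := ((a.1 + b.1) / 2, (a.2 + b.2) / 2).

Lemma dsq_midp p a b : dsq p (midp a b) = (dsq p a + dsq p b) / 2 - dsq a b / 4.
Proof. by rewrite /dsq /midp /=; field. Qed.

Lemma midpC a b : midp a b = midp b a.
Proof. by rewrite /midp (addrC a.1) (addrC a.2). Qed.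

Lemma segmentC a b : segment a b = segment b a.
Proof.
apply/seteqP; split=> x [t /=]; rewrite in_itv /= => /andP[t0 t1] <-.
all: exists (1 - t); [by rewrite /= in_itv /=; apply/andP; split; lra|].
all: by rewrite subKr addrC [X in (_, X)]addrC.
Qed.

Lemma segment_l a b : segment a b a.
Proof.
exists 0; first by rewrite /= in_itv /= lexx ler01.
by rewrite subr0 !mul1r !mul0r !addr0; case: a.
Qed.

Lemma segment_r a b : segment a b b.
Proof. by rewrite segmentC; apply: segment_l. Qed.

(** Stewart's theorem gives the lower bound (t - 1/4)^2 + 3/16, attained when [a], [b], [q] form an
    equilateral triangle. *)
Lemma mid_away_common a b q x : dsq a b = 1 -> dsq a q = 1 -> 1 <= dsq b q ->
  segment a q x -> 3 / 16 <= dsq (midp a b) x.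
Proof.
move=> ab aq bq [t /=]; rewrite in_itv /= => /andP[t0 t1] <-.
rewrite dsq_segment dsqC dsq_midp aq ab dsqpp [dsq _ q]dsqC dsq_midp.
rewrite (dsqC q a) (dsqC q b) aq ab; have := sqr_ge0 (t - 1 / 4); nra.
Qed.

Lemma mid_away_disjoint a b p q x : dsq a b = 1 -> dsq p q = 1 ->
  1 <= dsq a p -> 1 <= dsq a q -> 1 <= dsq b p -> 1 <= dsq b q ->
  segment p q x -> 3 / 16 <= dsq (midp a b) x.
Proof.
move=> ab pq ap aq bp bq [t /=]; rewrite in_itv /= => /andP[t0 t1] <-.
rewrite dsq_segment pq [dsq _ p]dsqC [dsq _ q]dsqC !dsq_midp ab.
rewrite (dsqC q a) (dsqC q b) (dsqC p a) (dsqC p b).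
have := sqr_ge0 (t - 1 / 2); nra.
Qed.

Lemma dsq_le_coord p q (r : R) : 0 <= r -> dsq p q <= r ^+ 2 ->
  `|p.1 - q.1| <= r /\ `|p.2 - q.2| <= r.
Proof.
move=> r0 h.
have abs_le u : u ^+ 2 <= r ^+ 2 -> `|u| <= r.
  by move=> h1; rewrite -ler_sqr ?nnegrE // real_normK ?num_real.
have := sqr_ge0 (p.1 - q.1); have := sqr_ge0 (p.2 - q.2).
by move: h; rewrite /dsq => h h1 h2; split; apply: abs_le; lra.
Qed.

End SquaredDistance.

(** * Continuity and connectedness in the plane *)

Section NearSeq.
Variable R : realType.
Implicit Types p q a b x y : (R * R)%type.

Lemma near_all_seq (T : eqType) (X : topologicalType) (z : X) (l : seq T)
    (P : T -> X -> Prop) :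
  (forall e, e \in l -> \forall y \near z, P e y) ->
  \forall y \near z, forall e, e \in l -> P e y.
Proof.
elim: l => [|e l IH] h; first by apply: nearW.
have h1 := h e (mem_head _ _).
have h2 : \forall y \near z, forall e', e' \in l -> P e' y.
  by apply: IH => e' e'l; apply: h; rewrite in_cons e'l orbT.
by apply: filterS2 h1 h2 => y h1 h2 e'; rewrite in_cons => /orP[/eqP ->|/h2].
Qed.

Lemma continuous_coord1 : continuous (fun y : R * R => y.1).
Proof. by move=> y; apply: cvg_fst. Qed.

Lemma continuous_coord2 : continuous (fun y : R * R => y.2).
Proof. by move=> y; apply: cvg_snd. Qed.

Lemma near_gt0 (X : topologicalType) (f : X -> R) (x : X) :
  {for x, continuous f} -> 0 < f x -> \forall y \near x, 0 < f y.
Proof. by move=> fc f0; exact: (cvgr_gt (f x) fc 0 f0). Qed.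

Lemma near_lt0 (X : topologicalType) (f : X -> R) (x : X) :
  {for x, continuous f} -> f x < 0 -> \forall y \near x, f y < 0.
Proof. by move=> fc f0; exact: (cvgr_lt (f x) fc 0 f0). Qed.

Lemma continuous_dsq p : continuous (dsq p).
Proof.
have -> : dsq p = fun y => (p.1 - y.1) * (p.1 - y.1) + (p.2 - y.2) * (p.2 - y.2).
  by apply/funext => y; rewrite /dsq !expr2.
have c1 y : (fun y : R * R => p.1 - y.1) @ y --> p.1 - y.1.
  by apply: cvgB; [exact: cvg_cst|exact: continuous_coord1].
have c2 y : (fun y : R * R => p.2 - y.2) @ y --> p.2 - y.2.
  by apply: cvgB; [exact: cvg_cst|exact: continuous_coord2].
by move=> y; apply: cvgD; apply: cvgM; (exact: c1 || exact: c2).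
Qed.

Lemma near_dsq p x (r : R) : dsq p x < r -> \forall y \near x, dsq p y < r.
Proof. exact: (cvgr_lt (dsq p x) (@continuous_dsq p x) r). Qed.

Definition lerp a b (t : R) : R * R :=
  ((1 - t) * a.1 + t * b.1, (1 - t) * a.2 + t * b.2).

Lemma continuous_pair (X : topologicalType) (f g : X -> R) :
  continuous f -> continuous g -> continuous (fun t => (f t, g t)).
Proof.
by move=> fc gc x; apply: (@cvg_pair _ _ _ _ (nbhs (f x)) (nbhs (g x)));
  [exact: fc|exact: gc].
Qed.

Lemma continuous_lerp a b : continuous (lerp a b).
Proof.
have aff (u v : R) : continuous (fun t : R => (1 - t) * u + t * v).
  move=> t; apply: cvgD; apply: cvgM; try exact: cvg_cst; try exact: cvg_id.
  by apply: cvgB; [exact: cvg_cst|exact: cvg_id].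
by apply: continuous_pair; apply: aff.
Qed.

Lemma connected_segment a b : connected (segment a b).
Proof.
rewrite /segment; apply: (connected_continuous_connected (f := lerp a b)).
  exact: segment_connected.
by apply: continuous_subspaceT => t; apply: continuous_lerp.
Qed.

Lemma closed_segment a b : closed (segment a b).
Proof.
apply: compact_closed; first exact: norm_hausdorff.
rewrite /segment; apply: (continuous_compact (f := lerp a b)).
  by apply: continuous_subspaceT => t; apply: continuous_lerp.
exact: segment_compact.
Qed.

(** The points of [A] satisfying [P] form a subset both open and closed in [A]. This is applied to
    faces, to the whole plane and to segments. *)
Lemma connected_loc_const (X : topologicalType) (A : set X) (P : X -> Prop) (x y : X) :
  connected A -> (forall z, A z -> \forall w \near z, A w -> (P w <-> P z)) ->
  A x -> A y -> P x -> P y.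
Proof.
move=> cA lc Ax Ay Px.
have E : A `&` [set z | P z] = A; last by have : A y := Ay; rewrite -E => -[].
apply: cA; first by exists x.
- exists [set w | A w -> P w]°; first exact: open_interior.
  apply/seteqP; split=> z [Az] h; split=> //; last by apply: interior_subset h Az.
  by apply: filterS (lc z Az) => w h1 /h1 ->.
- exists (~` [set w | A w -> ~ P w]°).
    by apply: open_closedC; apply: open_interior.
  apply/seteqP; split=> z [Az] h; split=> //.
    by move=> /interior_subset /(_ Az).
  apply: contrapT => nPz; apply: h.
  by apply: filterS (lc z Az) => w h1 /h1 ->.
Qed.
End NearSeq.

(** * Winding numbers by signed crossings *)

Section Winding.
Variable R : realType.
Implicit Types a b x : (R * R)%type.

(** Twice the signed area of the triangle [a b x]: positive when [x] is strictly to the left of the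
    line directed from [a] to [b]. *)
Definition cross a b x : R :=
  (b.1 - a.1) * (x.2 - a.2) - (b.2 - a.2) * (x.1 - a.1).

Lemma crossC a b x : cross b a x = - cross a b x.
Proof. by rewrite /cross; ring. Qed.

Lemma continuous_cross a b : continuous (cross a b).
Proof.
move=> x; apply: cvgB; apply: cvgM; try exact: cvg_cst.
  by apply: cvgB; [exact: continuous_coord2|exact: cvg_cst].
by apply: cvgB; [exact: continuous_coord1|exact: cvg_cst].
Qed.

Lemma cross0_segment a b x : cross a b x = 0 ->
  (a.2 < b.2 /\ a.2 <= x.2 <= b.2) \/ (a.2 = b.2 /\ a.1 < b.1 /\ a.2 = x.2 /\ a.1 <= x.1 <= b.1) ->
  segment a b x.
Proof.
move=> cr [[ab /andP[ax xb]]|[ab [ab1 [ax /andP[ax1 xb1]]]]].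
- have ba : 0 < b.2 - a.2 by lra.
  exists ((x.2 - a.2) / (b.2 - a.2)).
    by rewrite /= in_itv /= divr_ge0 ?ler_pdivrMr //; lra.
  rewrite [RHS]surjective_pairing; congr pair; apply: (mulIf (lt0r_neq0 ba)).
    set t := (x.2 - a.2) / _.
    have tE : t * (b.2 - a.2) = x.2 - a.2 by rewrite divfK ?lt0r_neq0.
    have -> : ((1 - t) * a.1 + t * b.1) * (b.2 - a.2) =
      a.1 * (b.2 - a.2) + (t * (b.2 - a.2)) * (b.1 - a.1) by ring.
    by rewrite tE; move: cr; rewrite /cross; lra.
  by field; lra.
- have ba : 0 < b.1 - a.1 by lra.
  exists ((x.1 - a.1) / (b.1 - a.1)).
    by rewrite /= in_itv /= divr_ge0 ?ler_pdivrMr //; lra.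
  rewrite [RHS]surjective_pairing; congr pair; last by rewrite -ab ax; ring.
  by field; lra.
Qed.

Definition below x a : bool := a.2 <= x.2.

(* Signed crossing of the directed edge [a b] with the horizontal ray going
   right from [x]; the half-open convention makes vertices on the ray count
   once. *)
Definition crossing x a b : int :=
  Posz [&& below x a, ~~ below x b & 0 < cross a b x] -
  Posz [&& below x b, ~~ below x a & cross a b x < 0].

Lemma crossingC x a b : crossing x b a = - crossing x a b.
Proof. by rewrite /crossing crossC oppr_gt0 oppr_lt0 opprB. Qed.

(* Moving from [x0] to a nearby [x] changes [crossing] by the coboundary of
   [shift], which cancels along a cycle. *)
Definition shift x0 x a : int :=
  Posz (x0.1 < a.1)%R * (Posz (below x a) - Posz (below x0 a)).

Definition crossing_corr x0 x a b : int :=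
  crossing x a b - shift x0 x a + shift x0 x b.

Lemma crossing_corrC x0 x a b : crossing_corr x0 x b a = - crossing_corr x0 x a b.
Proof. by rewrite /crossing_corr crossingC; ring. Qed.

Lemma near_below x0 a : a.2 != x0.2 -> \forall x \near x0, below x a = below x0 a.
Proof.
rewrite neq_lt /below => /orP[h|h].
  have : \forall x \near x0, a.2 < x.2.
    exact: (cvgr_gt x0.2 (@continuous_coord2 R x0) a.2 h).
  by apply: filterS => x h1; rewrite !ltW.
have : \forall x \near x0, x.2 < a.2.
  exact: (cvgr_lt x0.2 (@continuous_coord2 R x0) a.2 h).
by apply: filterS => x h1; rewrite !leNgt h h1.
Qed.

Lemma near_cross a b x0 : cross a b x0 != 0 ->
  \forall x \near x0, (0 < cross a b x) = (0 < cross a b x0) /\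
                      (cross a b x < 0) = (cross a b x0 < 0).
Proof.
rewrite neq_lt => /orP[h|h].
  apply: filterS (near_lt0 (@continuous_cross a b x0) h) => x h1.
  by rewrite h h1 !ltNge !ltW.
apply: filterS (near_gt0 (@continuous_cross a b x0) h) => x h1.
by rewrite h h1 !ltNge !ltW.
Qed.

(** If neither end is level with [x0], everything that enters [crossing] is stable near [x0]. At an
    end level with [x0], [crossing] switches with [below] exactly when that end is to the right of
    [x0], and [shift] removes this switch. *)
Lemma near_crossing_corr_lt a b x0 : a.2 < b.2 -> ~ segment a b x0 ->
  \forall x \near x0, crossing_corr x0 x a b = crossing x0 a b.
Proof.
move=> ab nseg.
have cr0 : a.2 <= x0.2 <= b.2 -> cross a b x0 != 0.
  by move=> h; apply/eqP => cr; apply: nseg; apply: cross0_segment => //; left.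
have [ax|xa|axE] := ltgtP a.2 x0.2; last first.
- have xb : x0.2 < b.2 by rewrite -axE.
  have crn : cross a b x0 != 0 by apply: cr0; rewrite axE lexx ltW.
  have := near_cross crn.
  have := near_below (negbT (gt_eqF xb)).
  apply: filterS2 => x bb [cp _].
  (* At the height of [a], the sign of [cross] tells whether [a] is to the right of [x0]. *)
  have cE : (0 < cross a b x0) = (x0.1 < a.1).
    rewrite /cross axE subrr mulr0 sub0r oppr_gt0 pmulr_rlt0 ?subr_lt0 //.
    by rewrite subr_gt0.
  rewrite /crossing_corr /crossing /shift bb cp cE.
  have -> : below x0 b = false by rewrite /below leNgt xb.
  have -> : below x0 a = true by rewrite /below axE lexx.
  by case: (below x a); case: (x0.1 < a.1); case: (x0.1 < b.1).
- have xb : x0.2 < b.2 by apply: lt_trans ab.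
  have := near_below (negbT (gt_eqF xa)).
  have := near_below (negbT (gt_eqF xb)).
  apply: filterS2 => x bb ba; rewrite /crossing_corr /crossing /shift bb ba.
  have -> : below x0 b = false by rewrite /below leNgt xb.
  have -> : below x0 a = false by rewrite /below leNgt xa.
  by rewrite /= !mulr0.
have na := near_below (negbT (lt_eqF ax)).
have [bx|xb|bxE] := ltgtP b.2 x0.2; last first.
- have crn : cross a b x0 != 0 by apply: cr0; rewrite bxE lexx ltW.
  have := near_cross crn.
  apply: filterS2 na => x ba [cp cn].
  have cE : (0 < cross a b x0) = (x0.1 < b.1).
    have -> : cross a b x0 = (b.2 - a.2) * (b.1 - x0.1) by rewrite /cross bxE; ring.
    by rewrite pmulr_rgt0 ?subr_gt0.
  rewrite /crossing_corr /crossing /shift ba cp cE.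
  have -> : below x0 b = true by rewrite /below bxE lexx.
  have -> : below x0 a = true by rewrite /below ltW.
  by case: (below x b); case: (x0.1 < b.1); case: (x0.1 < a.1).
- have crn : cross a b x0 != 0 by apply: cr0; rewrite !ltW.
  have nb := near_below (negbT (gt_eqF xb)).
  apply: filterS3 na nb (near_cross crn) => x ba bb [cp cn].
  by rewrite /crossing_corr /crossing /shift ba bb cp cn !subrr !mulr0 subr0 addr0.
- have := near_below (negbT (lt_eqF bx)).
  apply: filterS2 na => x ba bb; rewrite /crossing_corr /crossing /shift bb ba.
  have -> : below x0 b = true by rewrite /below ltW.
  have -> : below x0 a = true by rewrite /below ltW.
  by rewrite /= !mulr0.
Qed.

(** A horizontal edge is never crossed. If [x0] is level with it, both ends lie on the same side of
    [x0], so their shifts cancel; otherwise the shifts vanish near [x0]. *)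
Lemma near_crossing_corr_eq a b x0 : a.2 = b.2 -> a.1 < b.1 -> ~ segment a b x0 ->
  \forall x \near x0, crossing_corr x0 x a b = crossing x0 a b.
Proof.
move=> ab ab1 nseg.
have crE x : crossing x a b = 0.
  by rewrite /crossing /below ab; case: (b.2 <= x.2).
have [axE|ax] := eqVneq a.2 x0.2.
- have E : (x0.1 < a.1) = (x0.1 < b.1).
    have [h|h] := ltP x0.1 a.1; first by rewrite (lt_trans h).
    apply/esym/negbTE; rewrite -leNgt leNgt; apply/negP => h1.
    apply: nseg; apply: cross0_segment.
      by rewrite /cross -ab axE; ring.
    by right; do !split => //; rewrite h ltW.
  apply: (@filterE _ (nbhs x0)) => x.
  by rewrite /crossing_corr !crE /shift /below -ab E; ring.
- apply: filterS (near_below ax) => x ba.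
  have bb : below x b = below x0 b by move: ba; rewrite /below -ab.
  by rewrite /crossing_corr !crE /shift ba bb !subrr !mulr0.
Qed.

Lemma near_crossing_corr a b x0 : a != b -> ~ segment a b x0 ->
  \forall x \near x0, crossing_corr x0 x a b = crossing x0 a b.
Proof.
move=> ab nseg; have nseg' : ~ segment b a x0 by rewrite segmentC.
have sym : (\forall x \near x0, crossing_corr x0 x b a = crossing x0 b a) ->
    \forall x \near x0, crossing_corr x0 x a b = crossing x0 a b.
  by apply: filterS => x; rewrite crossing_corrC crossingC => /oppr_inj.
have [h|h|h] := ltgtP a.2 b.2.
- exact: near_crossing_corr_lt.
- by apply: sym; apply: near_crossing_corr_lt.
have [h1|h1|h1] := ltgtP a.1 b.1.
- exact: near_crossing_corr_eq.
- by apply: sym; apply: near_crossing_corr_eq.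
by move: ab; rewrite [a]surjective_pairing h h1 -surjective_pairing eqxx.
Qed.

(** [K] is 0 for an ascending edge and -1 for a descending one. On a horizontal edge [crossing] is
    0, and the jump comes from the shift of the end to the right of the midpoint. *)
Lemma crossing_corr_jump a b : a != b -> exists K : int,
  \forall x \near midp a b,
    (0 < cross a b x -> crossing_corr (midp a b) x a b = K + 1) /\
    (cross a b x < 0 -> crossing_corr (midp a b) x a b = K).
Proof.
move=> ab; set m := midp a b.
have [h|h|h] := ltgtP a.2 b.2.
- have am : a.2 < m.2 by rewrite /m /=; lra.
  have mb : m.2 < b.2 by rewrite /m /=; lra.
  exists 0; have := near_below (negbT (gt_eqF mb)).
  have := near_below (negbT (lt_eqF am)).
  apply: filterS2 => x ba bb; rewrite /crossing_corr /crossing /shift bb ba.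
  have -> : below m b = false by rewrite /below leNgt mb.
  have -> : below m a = true by rewrite /below ltW.
  rewrite !subrr !mulr0 subr0 addr0.
  by split=> h1; rewrite ?h1 //= ltNge ltW.
- have am : m.2 < a.2 by rewrite /m /=; lra.
  have mb : b.2 < m.2 by rewrite /m /=; lra.
  exists (-1); have := near_below (negbT (lt_eqF mb)).
  have := near_below (negbT (gt_eqF am)).
  apply: filterS2 => x ba bb; rewrite /crossing_corr /crossing /shift bb ba.
  have -> : below m a = false by rewrite /below leNgt am.
  have -> : below m b = true by rewrite /below ltW.
  rewrite !subrr !mulr0 subr0 addr0.
  by split=> h1; rewrite ?h1 //= ltNge ltW.
have crE x : crossing x a b = 0.
  by rewrite /crossing /below h; case: (b.2 <= x.2).
have mE : m.2 = b.2 by rewrite /m /= h; field.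
have bE x : below x a = (b.2 <= x.2) by rewrite /below h.
have cE x : cross a b x = (b.1 - a.1) * (x.2 - b.2) by rewrite /cross h; ring.
have [h1|h1|h1] := ltgtP a.1 b.1.
- exists (-1); apply: (@filterE _ (nbhs m)) => x; rewrite /crossing_corr crE /shift !bE /below mE lexx cE.
  have -> : m.1 < a.1 = false by apply/negbTE; rewrite -leNgt /m /=; lra.
  have -> : m.1 < b.1 by rewrite /m /=; lra.
  rewrite pmulr_rgt0 ?pmulr_rlt0 ?subr_gt0 // subr_lt0.
  by case: (ltgtP b.2 x.2).
- exists 0; apply: (@filterE _ (nbhs m)) => x; rewrite /crossing_corr crE /shift !bE /below mE lexx cE.
  have -> : m.1 < a.1 by rewrite /m /=; lra.
  have -> : m.1 < b.1 = false by apply/negbTE; rewrite -leNgt /m /=; lra.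
  rewrite nmulr_rgt0 ?nmulr_rlt0 ?subr_lt0 // subr_gt0.
  by case: (ltgtP b.2 x.2).
by move: ab; rewrite [a]surjective_pairing h h1 -surjective_pairing eqxx.
Qed.

Lemma crossing_right x a b : a.1 <= x.1 -> b.1 <= x.1 -> crossing x a b = 0.
Proof.
move=> ax bx; rewrite /crossing /below.
have [h|h] /= := leP a.2 x.2; have [h1|h1] //= := leP b.2 x.2.
  by rewrite ltNge; suff -> : cross a b x <= 0 by []; rewrite /cross; nra.
by rewrite ltNge; suff -> : 0 <= cross a b x by []; rewrite /cross; nra.
Qed.

Lemma crossing_left x a b : x.1 < a.1 -> x.1 < b.1 ->
  crossing x a b = Posz (below x a) - Posz (below x b).
Proof.
move=> ax bx; rewrite /crossing /below.
have [h|h] /= := leP a.2 x.2; have [h1|h1] //= := leP b.2 x.2.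
  by suff -> : 0 < cross a b x by []; rewrite /cross; nra.
by suff -> : cross a b x < 0 by []; rewrite /cross; nra.
Qed.

Lemma crossing_above x a b : a.2 < x.2 -> b.2 < x.2 -> crossing x a b = 0.
Proof. by move=> ax bx; rewrite /crossing /below !ltW. Qed.

Lemma crossing_below x a b : x.2 < a.2 -> x.2 < b.2 -> crossing x a b = 0.
Proof. by move=> ax bx; rewrite /crossing /below !leNgt ax bx. Qed.

Variables (T : eqType) (c : T -> R * R).
Implicit Types B : seq (T * T).

Definition winding B x : int := \sum_(d <- B) crossing x (c d.1) (c d.2).

(** [B] is a 1-cycle: each vertex is a tail as often as a head, so coboundaries of vertex functions
    sum to 0 along [B]. *)
Definition balanced B := perm_eq (map fst B) (map snd B).

Lemma balanced_sum B (f : T -> int) : balanced B ->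
  \sum_(d <- B) f d.1 = \sum_(d <- B) f d.2.
Proof.
by move=> bal; rewrite -(big_map fst xpredT f) -(big_map snd xpredT f); apply: perm_big.
Qed.

Lemma winding_corr B x0 x : balanced B ->
  winding B x = \sum_(d <- B) crossing_corr x0 x (c d.1) (c d.2).
Proof.
move=> bal; rewrite /crossing_corr big_split sumrB /=.
by rewrite (balanced_sum (fun v => shift x0 x (c v)) bal) subrK.
Qed.

Lemma winding_loc_const B x0 : balanced B ->
  (forall d, d \in B -> c d.1 != c d.2 /\ ~ segment (c d.1) (c d.2) x0) ->
  \forall x \near x0, winding B x = winding B x0.
Proof.
move=> bal h.
have : \forall x \near x0, forall d, d \in B ->
    crossing_corr x0 x (c d.1) (c d.2) = crossing x0 (c d.1) (c d.2).
  by apply: near_all_seq => d /h[dn ds]; apply: near_crossing_corr.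
apply: filterS => x hx; rewrite (winding_corr x0) //.
by rewrite /winding !big_seq; apply: eq_bigr => d /hx.
Qed.

Lemma sum_pred1 B d0 : uniq B -> \sum_(d <- B) Posz (d == d0) = Posz (d0 \in B).
Proof.
move=> uB; rewrite -count_uniq_mem //.
by elim: B {uB} => [|d l IH]; rewrite ?big_nil // big_cons IH /= PoszD.
Qed.

(** After the correction by [shift], only the terms of [(i, j)] and [(j, i)] jump at the midpoint,
    by 1 and -1; [e d] records the jump of the term of [d]. *)
Lemma winding_jump B i j : balanced B -> uniq B -> c i != c j ->
  (forall d, d \in B -> c d.1 != c d.2) ->
  (forall d, d \in B -> d != (i, j) -> d != (j, i) ->
     ~ segment (c d.1) (c d.2) (midp (c i) (c j))) ->
  exists K : int, \forall x \near midp (c i) (c j),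
    (0 < cross (c i) (c j) x ->
       winding B x = K + (Posz ((i, j) \in B) - Posz ((j, i) \in B))) /\
    (cross (c i) (c j) x < 0 -> winding B x = K).
Proof.
move=> bal uB cij cB sB; set m := midp (c i) (c j).
pose e d : int := Posz (d == (i, j)) - Posz (d == (j, i)).
have ij : (i, j) != (j, i) by apply: contraNneq cij => -[->].
(* Membership stands under the existential so that a constant can be chosen for every [d]. *)
have H d : exists K : int, d \in B -> \forall x \near m,
    (0 < cross (c i) (c j) x -> crossing_corr m x (c d.1) (c d.2) = K + e d) /\
    (cross (c i) (c j) x < 0 -> crossing_corr m x (c d.1) (c d.2) = K).
  have [dij|dij] := eqVneq d (i, j).
    have [K hK] := crossing_corr_jump cij; exists K => _.
    by rewrite /e dij eqxx (negbTE ij) subr0.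
  have [dji|dji] := eqVneq d (j, i).
    have [K hK] := crossing_corr_jump cij; exists (- K) => _.
    rewrite /e dji eqxx eq_sym (negbTE ij) sub0r.
    apply: filterS hK => x [h1 h2].
    by rewrite crossing_corrC; split=> h; [rewrite h1 // opprD|rewrite h2].
  exists (crossing m (c d.1) (c d.2)) => dB.
  apply: filterS (near_crossing_corr (cB d dB) (sB d dB dij dji)) => x ->.
  by rewrite /e (negbTE dij) (negbTE dji) addr0.
pose K d := sval (cid (H d)).
exists (\sum_(d <- B) K d).
have : \forall x \near m, forall d, d \in B ->
    (0 < cross (c i) (c j) x -> crossing_corr m x (c d.1) (c d.2) = K d + e d) /\
    (cross (c i) (c j) x < 0 -> crossing_corr m x (c d.1) (c d.2) = K d).
  by apply: near_all_seq => d dB; rewrite /K; case: cid => /= k; apply.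
apply: filterS => x hx; rewrite (winding_corr m) //; split=> h.
  have -> : Posz ((i, j) \in B) - Posz ((j, i) \in B) = \sum_(d <- B) e d.
    by rewrite sumrB !sum_pred1.
  by rewrite -big_split /= !big_seq; apply: eq_bigr => d /hx[/(_ h)].
by rewrite !big_seq; apply: eq_bigr => d /hx[_ /(_ h)].
Qed.

(** To the right of, above and below the box every crossing vanishes. To the left of it the
    crossings are the coboundary of [below], which cancels because [B] is balanced. *)
Lemma winding_far B p (r : R) x : balanced B ->
  (forall d, d \in B -> `|(c d.1).1 - p.1| <= r /\ `|(c d.1).2 - p.2| <= r) ->
  winding B x != 0 -> `|x.1 - p.1| <= r /\ `|x.2 - p.2| <= r.
Proof.
move=> bal h1.
have h2 d : d \in B -> `|(c d.2).1 - p.1| <= r /\ `|(c d.2).2 - p.2| <= r.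
  move=> dB; have : d.2 \in map snd B by apply: map_f.
  by rewrite -(perm_mem bal) => /mapP[d' /h1 h ->].
move=> w; suff H : [/\ x.1 - p.1 <= r, - r <= x.1 - p.1, x.2 - p.2 <= r & - r <= x.2 - p.2].
  by case: H => a1 a2 a3 a4; rewrite !ler_norml a1 a2 a3 a4.
split; rewrite leNgt; apply: contra w => hx; apply/eqP.
- rewrite /winding big_seq big1 // => d dB; apply: crossing_right.
    by have [+ _] := h1 d dB; rewrite ler_norml => /andP[]; lra.
  by have [+ _] := h2 d dB; rewrite ler_norml => /andP[]; lra.
- rewrite /winding (eq_big_seq (fun d => Posz (below x (c d.1)) - Posz (below x (c d.2)))).
    by rewrite sumrB (balanced_sum (fun v => Posz (below x (c v))) bal) subrr.
  move=> d dB; apply: crossing_left.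
    by have [+ _] := h1 d dB; rewrite ler_norml => /andP[]; lra.
  by have [+ _] := h2 d dB; rewrite ler_norml => /andP[]; lra.
- rewrite /winding big_seq big1 // => d dB; apply: crossing_above.
    by have [_] := h1 d dB; rewrite ler_norml => /andP[]; lra.
  by have [_] := h2 d dB; rewrite ler_norml => /andP[]; lra.
- rewrite /winding big_seq big1 // => d dB; apply: crossing_below.
    by have [_] := h1 d dB; rewrite ler_norml => /andP[]; lra.
  by have [_] := h2 d dB; rewrite ler_norml => /andP[]; lra.
Qed.

End Winding.

(** * Unit-distance graphs of packings *)

Section UnitDistance.
Variables (R : realType) (T : eqType) (c : T -> R * R).
Notation adj := (unit_distance c).

Lemma adjE i j : adj i j = (dsq (c i) (c j) == 1).
Proof. exact: edist_eq1. Qed.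

Lemma adj_dsq i j : adj i j -> dsq (c i) (c j) = 1.
Proof. by rewrite adjE => /eqP. Qed.

Lemma adjC i j : adj i j = adj j i.
Proof. by rewrite !adjE dsqC. Qed.

Lemma adj_cneq i j : adj i j -> c i != c j.
Proof. by rewrite adjE; apply: contraTneq => ->; rewrite dsqpp eq_sym oner_eq0. Qed.

Lemma walk_cat i j k m n : walk adj i j m -> walk adj j k n -> walk adj i k (m + n).
Proof.
move=> [p [pp <- <-]] [q [qq <- <-]]; exists (p ++ q).
by rewrite cat_path last_cat size_cat pp qq.
Qed.

Lemma walk1 i j : adj i j -> walk adj i j 1.
Proof. by move=> ij; exists [:: j]; rewrite /= ij. Qed.

Lemma adj_coord i j : adj i j -> `|(c i).1 - (c j).1| <= 1 /\ `|(c i).2 - (c j).2| <= 1.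
Proof. by move=> /adj_dsq ij; apply: dsq_le_coord; rewrite ?ler01 // ij expr1n. Qed.

Lemma walk_coord i j m : walk adj i j m ->
  `|(c i).1 - (c j).1| <= m%:R /\ `|(c i).2 - (c j).2| <= m%:R.
Proof.
move=> [p [pp <- <-]]; elim: p i pp => [|k p IH] i /=; first by rewrite !subrr normr0.
move=> /andP[/adj_coord[h1 h2] /IH[h3 h4]]; rewrite -nat1r.
by split; apply: le_trans (ler_distD _ _ _) (lerD _ _); first [exact: h1|exact: h2|idtac].
Qed.

Lemma graph_dist_le i j n : walk adj i j n -> (graph_dist adj i j <= n)%N.
Proof.
move=> w; rewrite /graph_dist; case: pselect => // h.
by case: ex_minnP => m _; apply; apply/asboolP.
Qed.

Lemma graph_dist_walk i j n : walk adj i j n -> walk adj i j (graph_dist adj i j).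
Proof.
move=> w; rewrite /graph_dist; case: pselect => [h|[]]; last by exists n.
by case: ex_minnP => m /asboolP.
Qed.

End UnitDistance.

Section Packing.
Variables (R : realType) (c : nat -> R * R).

(** The midpoint of two centres less than 1 apart would lie in both open disks. *)
Lemma penny_sep : penny_packing c -> forall i j, i != j -> 1 <= dsq (c i) (c j).
Proof.
move=> pk i j ij; rewrite leNgt; apply/negP => h.
have h2 : (0 : R) < 2^-1 by rewrite invr_gt0.
have e2 : (2^-1 : R) ^+ 2 = 1 / 4 by field.
suff : i = j by apply/eqP.
apply: pk => //; exists (midp (c i) (c j)).
split; rewrite /disk /= edist_lt // dsq_midp dsqpp e2.
  by lra.
by rewrite dsqC; lra.
Qed.

Hypothesis sep : forall i j, i != j -> 1 <= dsq (c i) (c j).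
Hypothesis conn : connected_graph (unit_distance c).

Notation adj := (unit_distance c).

Definition in_box (p : R * R) (r : R) i : bool :=
  (`|(c i).1 - p.1| <= r) && (`|(c i).2 - p.2| <= r).

Lemma dsq_in_box p (r : R) i : 0 <= r -> dsq p (c i) <= r ^+ 2 -> in_box p r i.
Proof.
by move=> r0; rewrite dsqC => /(dsq_le_coord r0) [h1 h2]; apply/andP.
Qed.

(* Each square cell of side 1/2 contains at most one centre. *)
Lemma box_finite p (K : nat) : exists l : seq nat,
  (size l <= (4 * K + 1) ^ 2)%N /\ forall i, (i \in l) = in_box p K%:R i.
Proof.
pose cell (a b : nat) i :=
  (a%:R <= 2 * ((c i).1 - p.1) + 2 * K%:R < a.+1%:R) &&
  (b%:R <= 2 * ((c i).2 - p.2) + 2 * K%:R < b.+1%:R).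
have cell_uniq a b i j : cell a b i -> cell a b j -> i = j.
  rewrite /cell -!natr1 => /andP[/andP[h1 h2] /andP[h3 h4]] /andP[/andP[h5 h6] /andP[h7 h8]].
  apply/eqP; apply/negP => /negP /sep.
  rewrite /dsq leNgt => /negP; apply.
  have u1 : (2 * ((c i).1 - (c j).1)) ^+ 2 < 1 by nra.
  have u2 : (2 * ((c i).2 - (c j).2)) ^+ 2 < 1 by nra.
  by move: u1 u2; rewrite !exprMn; lra.
(* In the box, 2 u + 2 K lies in [0, 4 K], so its integer part takes at most 4 K + 1 values. An
   empty cell yields the default 0, which the filter keeps only if it is in the box. *)
pose n := (4 * K + 1)%N.
pose l0 := [seq xget 0%N [set i | cell a b i] | a <- iota 0 n, b <- iota 0 n].
exists [seq i <- l0 | in_box p K%:R i]; split.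
  rewrite size_filter; apply: leq_trans (count_size _ _) _.
  by rewrite size_allpairs !size_iota.
move=> i; rewrite mem_filter.
case: (boolP (in_box p K%:R i)) => //= /andP[].
rewrite !ler_norml => /andP[h1 h2] /andP[h3 h4].
pose f (u : R) := Num.truncn (2 * u + 2 * K%:R).
have fP (u : R) : - K%:R <= u -> u <= K%:R ->
    (f u < n)%N /\ (f u)%:R <= 2 * u + 2 * K%:R < (f u).+1%:R.
  move=> u1 u2; have u0 : 0 <= 2 * u + 2 * K%:R by lra.
  have /andP[v1 v2] := truncn_itv u0.
  split; last by rewrite v1 v2.
  rewrite -(ltr_nat R); apply: (le_lt_trans v1).
  by rewrite /n natrD natrM; lra.
have [n1 v1] := fP _ h1 h2; have [n2 v2] := fP _ h3 h4.
have ci : cell (f ((c i).1 - p.1)) (f ((c i).2 - p.2)) i by rewrite /cell v1 v2.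
apply/allpairsP; exists (f ((c i).1 - p.1), f ((c i).2 - p.2)); split=> /=.
- by rewrite mem_iota.
- by rewrite mem_iota.
- apply: (cell_uniq _ _ _ _ ci).
  exact: (@xgetPex _ 0%N [set k | cell (f ((c i).1 - p.1)) (f ((c i).2 - p.2)) k]
    (ex_intro _ i ci)).
Qed.

Definition box_seq p K : seq nat := sval (cid (box_finite p K)).

Lemma box_seq_size p K : (size (box_seq p K) <= (4 * K + 1) ^ 2)%N.
Proof. by rewrite /box_seq; case: cid => l []. Qed.

Lemma mem_box_seq p K i : (i \in box_seq p K) = in_box p K%:R i.
Proof. by rewrite /box_seq; case: cid => l []. Qed.

Lemma exists_far p K : exists i, ~~ in_box p K%:R i.
Proof.
apply: contrapT => /forallNP h.
have : (size (iota 0 (size (box_seq p K)).+1) <= size (box_seq p K))%N.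
  apply: uniq_leq_size; first exact: iota_uniq.
  by move=> i _; rewrite mem_box_seq; apply/negP => /negP /h.
by rewrite size_iota ltnn.
Qed.

(** A walk from [i] to the different vertex [i.+1] has a first step. *)
Lemma exists_nbr i : exists j, adj i j.
Proof.
have [n [[|j s] [/=]]] := conn i i.+1.
  by move=> _ /n_Sn.
by move=> /andP[ij _] _ _; exists j.
Qed.

Definition nbrs i : seq nat := [seq j <- box_seq (c i) 1 | adj i j].

Lemma mem_nbrs i j : (j \in nbrs i) = adj i j.
Proof.
rewrite mem_filter; case: (boolP (adj i j)) => //= ij.
rewrite mem_box_seq; apply: dsq_in_box; first by rewrite ler01.
by rewrite adj_dsq // expr1n.
Qed.

(** A crude degree bound: 25 is (4 K + 1)^2 for K = 1. *)
Lemma nbrs_size i : (size (nbrs i) <= 25)%N.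
Proof.
rewrite size_filter; apply: leq_trans (count_size _ _) _.
exact: (box_seq_size (c i) 1).
Qed.

Notation graph := (penny_embedding c).

Lemma graphP x : graph x <-> exists i j, adj i j /\ segment (c i) (c j) x.
Proof.
split; last by right.
case=> // -[i _ <-]; have [j ij] := exists_nbr i.
by exists i, j; split=> //; apply: segment_l.
Qed.

Lemma dsq_segment_le i j x : adj i j -> segment (c i) (c j) x -> dsq x (c i) <= 1.
Proof.
move=> /adj_dsq ij [t /=]; rewrite in_itv /= => /andP[t0 t1] <-.
by rewrite dsqC dsq_segment dsqpp ij; nra.
Qed.

Lemma open_complement : open (~` graph).
Proof.
rewrite openE => x ngx; rewrite /interior.
(* An edge passing within distance 1 of [x] has both ends within distance 2 of [x], hence in this
   finite box; only finitely many closed segments have to be avoided. *)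
set l := box_seq x 3.
have H : \forall y \near x, forall d, d \in [seq (i, j) | i <- l, j <- l] ->
    adj d.1 d.2 -> ~ segment (c d.1) (c d.2) y.
  apply: near_all_seq => d _.
  case: (boolP (adj d.1 d.2)) => [dd|_]; last by apply: (@filterE _ (nbhs x)).
  have : (~` segment (c d.1) (c d.2)) x.
    by move=> s; apply: ngx; apply/graphP; exists d.1, d.2.
  have : open (~` segment (c d.1) (c d.2)).
    exact/closed_openC/closed_segment.
  rewrite openE => /(_ x) h /h; rewrite /interior.
  by apply: filterS => y ny _.
have N : \forall y \near x, dsq x y < 1 by apply: near_dsq; rewrite dsqpp.
apply: filterS2 H N => y H N /graphP [i [j [ij s]]].
have near_vertex k : dsq y (c k) <= 1 -> k \in l.
  move=> h; rewrite /l mem_box_seq; apply: dsq_in_box; first exact: ler0n.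
  move: h N; rewrite /dsq.
  (* These squares give (u + v)^2 <= 2 (u^2 + v^2) in each coordinate, which replaces the triangle
     inequality. *)
  have := sqr_ge0 (x.1 - y.1 - (y.1 - (c k).1)).
  have := sqr_ge0 (x.2 - y.2 - (y.2 - (c k).2)).
  by rewrite !expr2; lra.
apply: (H (i, j)) => //.
apply/allpairsP; exists (i, j); split => //=; apply: near_vertex.
  exact: dsq_segment_le s.
by apply: (@dsq_segment_le j i); [rewrite adjC|rewrite segmentC].
Qed.

Lemma disk_graph i x : disk (c i) 2^-1 x -> graph x ->
  exists2 j, adj i j & segment (c i) (c j) x.
Proof.
rewrite /disk /= edist_lt ?invr_gt0 // => h /graphP [a [b [ab s]]].
have [ai|ai] := eqVneq a i; first by exists b; rewrite -ai.
have [bi|bi] := eqVneq b i; first by exists a; rewrite -bi; [rewrite adjC|rewrite segmentC].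
have ia : i != a by rewrite eq_sym.
have ib : i != b by rewrite eq_sym.
have := edge_away (adj_dsq ab) (sep ia) (sep ib) s.
have e2 : (2^-1 : R) ^+ 2 = 1 / 4 by field.
by move: h; rewrite e2; lra.
Qed.

Lemma midp_graph i j a b x : adj i j -> adj a b ->
  dsq (midp (c i) (c j)) x < 3 / 16 -> segment (c a) (c b) x ->
  (a, b) = (i, j) \/ (a, b) = (j, i).
Proof.
move=> ij ab h s; apply: contrapT => /not_orP[n1 n2].
suff : 3 / 16 <= dsq (midp (c i) (c j)) x by rewrite leNgt h.
have dij := adj_dsq ij; have dab := adj_dsq ab.
have dji : dsq (c j) (c i) = 1 by rewrite dsqC.
have dba : dsq (c b) (c a) = 1 by rewrite dsqC.
have [ai|ai] := eqVneq a i.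
  have bj : j != b by apply/eqP => bj; apply: n1; rewrite ai bj.
  by rewrite ai in s dab; apply: (mid_away_common dij dab (sep bj) s).
have [aj|aj] := eqVneq a j.
  have bi : i != b by apply/eqP => bi; apply: n2; rewrite aj bi.
  by rewrite aj in s dab; rewrite midpC; apply: (mid_away_common dji dab (sep bi) s).
have [bi|bi] := eqVneq b i.
  have aj' : j != a by rewrite eq_sym.
  rewrite segmentC bi in s; rewrite bi in dba.
  exact: (mid_away_common dij dba (sep aj') s).
have [bj|bj] := eqVneq b j.
  have ai' : i != a by rewrite eq_sym.
  rewrite segmentC bj in s; rewrite bj in dba; rewrite midpC.
  exact: (mid_away_common dji dba (sep ai') s).
apply: (mid_away_disjoint dij dab _ _ _ _ s); apply: sep; by rewrite eq_sym.
Qed.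

(* Disks of radius 1/2 about the vertices and of radius sqrt(3/16) about the
   midpoints cover the edges, and meet no other edges. *)
Lemma graph_cover x : graph x ->
  (exists i, disk (c i) 2^-1 x) \/
  (exists i j, adj i j /\ dsq (midp (c i) (c j)) x < 3 / 16).
Proof.
move=> /graphP [i [j [ij [t /=]]]]; rewrite in_itv /= => /andP[t0 t1] <-.
have dij := adj_dsq ij.
have e2 : (2^-1 : R) ^+ 2 = 1 / 4 by field.
have [th|th] := ltP t (1 / 4).
  left; exists i; rewrite /disk /= edist_lt ?invr_gt0 // e2 dsq_segment dsqpp dij.
  by nra.
have [th'|th'] := ltP (3 / 4) t.
  left; exists j; rewrite /disk /= edist_lt ?invr_gt0 // e2 dsq_segment dsqpp.
  by rewrite [dsq (c j) _]dsqC dij; nra.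
right; exists i, j; split => //.
rewrite dsq_segment ![dsq (midp _ _) _]dsqC !dsq_midp !dsqpp dij.
by rewrite [dsq (c j) _]dsqC dij; nra.
Qed.

End Packing.

(** * Sectors at a vertex and the rotation system *)

Section Polar.
Variable R : realType.
Implicit Types p q x : (R * R)%type.

Lemma exists_argmin (T : eqType) (f : T -> R) (l : seq T) : l != [::] ->
  exists2 x, x \in l & forall y, y \in l -> f x <= f y.
Proof.
elim: l => // a [|b l] IH _.
  by exists a; rewrite ?mem_head // => y; rewrite mem_seq1 => /eqP ->.
have [//|x xl xm] := IH; have [h|h] := leP (f a) (f x).
  exists a; first exact: mem_head.
  move=> y; rewrite in_cons => /orP[/eqP ->//|/xm]; exact: le_trans.
exists x; first by rewrite in_cons xl orbT.
by move=> y; rewrite in_cons => /orP[/eqP ->|/xm//]; exact: ltW.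
Qed.

Lemma cosD2pi1 (t : R) : cos (t + 2 * pi) = cos t.
Proof. by rewrite mulr_natl cosD2pi. Qed.

Lemma sinD2pi1 (t : R) : sin (t + 2 * pi) = sin t.
Proof. by rewrite mulr_natl sinD2pi. Qed.

(** With the half angle, cos d = 1 - 2 sin(|d| / 2)^2, and the sine is positive on (0, pi). *)
Lemma cos_eq1 (d : R) : `|d| < 2 * pi -> cos d = 1 -> d = 0.
Proof.
move=> dl c1; apply/eqP; apply: contraPT c1 => d0.
have h : 0 < `|d| / 2 < pi.
  by apply/andP; split; [rewrite divr_gt0 ?normr_gt0|lra].
have /(_ h) s0 := @sin_gt0_pi R (`|d| / 2).
have -> : cos d = cos ((`|d| / 2) *+ 2).
  have -> : (`|d| / 2) *+ 2 = `|d| by rewrite -mulr_natr; field.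
  by have [dd|dd] := ger0P d; rewrite ?cosN.
rewrite cos_mulr2n; have := cos2Dsin2 (`|d| / 2) => e h1.
have : sin (`|d| / 2) ^+ 2 = 0 by move: h1; rewrite mulr2n; lra.
by move/eqP; rewrite sqrf_eq0 gt_eqF.
Qed.

Lemma exists_angle (u v : R) : u ^+ 2 + v ^+ 2 = 1 ->
  exists2 t : R, 0 <= t < 2 * pi & u = cos t /\ v = sin t.
Proof.
move=> uv.
have u1 : -1 <= u <= 1.
  have := sqr_ge0 v => v2; apply/andP; split; nra.
have := acos_ge0 u1; have := acos_lepi u1; have := pi_gt0 R => pi0 a1 a0.
have sE : sin (acos u) = `|v|.
  by rewrite sin_acos // -sqrtr_sqr; congr Num.sqrt; lra.
have cE : cos (acos u) = u by rewrite acosK // in_itv.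
have [v0|v0] := leP 0 v.
  exists (acos u); first by apply/andP; split; lra.
  by rewrite cE sE ger0_norm.
exists (- acos u + 2 * pi).
  have : 0 < sin (acos u) by rewrite sE normr_gt0 lt_eqF.
  have [->|] := eqVneq (acos u) 0; first by rewrite sin0 ltxx.
  by move=> n0 _; have : 0 < acos u by [rewrite lt0r n0]; move=> h; apply/andP; split; lra.
by rewrite cosD2pi1 sinD2pi1 cosN sinN cE sE ltr0_norm // opprK.
Qed.

Definition polar p (r t : R) : R * R := (p.1 + r * cos t, p.2 + r * sin t).

Lemma polarD2pi p r t : polar p r (t + 2 * pi) = polar p r t.
Proof. by rewrite /polar cosD2pi1 sinD2pi1. Qed.

Lemma dsq_polar p r t : dsq p (polar p r t) = r ^+ 2.
Proof.
rewrite /dsq /polar /=.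
have -> : r ^+ 2 = r ^+ 2 * (cos t ^+ 2 + sin t ^+ 2) by rewrite cos2Dsin2 mulr1.
by ring.
Qed.

Lemma exists_polar p x : exists t : R,
  0 <= t < 2 * pi /\ x = polar p (Num.sqrt (dsq p x)) t.
Proof.
have [d0|d0] := eqVneq (dsq p x) 0.
  exists 0; rewrite lexx mulr_gt0 ?pi_gt0 //; split=> //.
  rewrite d0 sqrtr0 /polar !mul0r !addr0.
  have h1 := sqr_ge0 (p.1 - x.1); have h2 := sqr_ge0 (p.2 - x.2).
  move: d0; rewrite /dsq => d0.
  have /eqP : (p.1 - x.1) ^+ 2 = 0 by lra.
  have /eqP : (p.2 - x.2) ^+ 2 = 0 by lra.
  rewrite !sqrf_eq0 !subr_eq0 => /eqP -> /eqP ->.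
  by case: (x).
set r := Num.sqrt _.
have r2 : r ^+ 2 = dsq p x by rewrite sqr_sqrtr ?dsq_ge0.
have r0 : r != 0 by rewrite -sqrf_eq0 r2.
have [|t tb [tc ts]] := @exists_angle ((x.1 - p.1) / r) ((x.2 - p.2) / r).
  by rewrite !expr_div_n r2 -mulrDl -[X in X / _]/(dsq x p) dsqC divff.
exists t; split=> //; rewrite /polar -tc -ts !(mulrC r) !divfK // !(addrC p.1) !(addrC p.2) !subrK.
by case: (x).
Qed.

Definition angle p x : R := sval (cid (exists_polar p x)).

Lemma angle_itv p x : 0 <= angle p x < 2 * pi.
Proof. by rewrite /angle; case: cid => t []. Qed.

Lemma angle_polar p x : x = polar p (Num.sqrt (dsq p x)) (angle p x).
Proof. by rewrite /angle; case: cid => t []. Qed.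

Lemma polar_inj p r r' t t' : 0 < r -> 0 <= r' -> `|t - t'| < 2 * pi ->
  polar p r t = polar p r' t' -> t = t'.
Proof.
move=> r0 r0' tt E.
have rr : r = r'.
  apply/eqP; rewrite -(eqrXn2 (n := 2)) ?(ltW r0) //.
  by rewrite -(dsq_polar p r t) E dsq_polar.
subst r'.
have cE := mulfI (lt0r_neq0 r0) (@addrI _ p.1 _ _ (congr1 fst E)).
have sE := mulfI (lt0r_neq0 r0) (@addrI _ p.2 _ _ (congr1 snd E)).
apply/eqP; rewrite -subr_eq0; apply/eqP; apply: cos_eq1 => //.
by rewrite cosB cE sE -!expr2 cos2Dsin2.
Qed.

(* The counterclockwise angle from [u] to [v], in (0, 2 pi]. *)
Definition ccw (u v : R) : R := if u < v then v - u else v - u + 2 * pi.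

Lemma conv_lt (t u v a b : R) : 0 <= t -> t <= 1 -> u < a -> v < b ->
  (1 - t) * u + t * v < (1 - t) * a + t * b.
Proof.
move=> t0 t1 ua vb; have := ltW ua; rewrite -subr_ge0 => ua'.
have := mulr_ge0 (_ : 0 <= 1 - t) ua'; rewrite subr_ge0 => /(_ t1) h.
have [->|tn] := eqVneq t 0; first by lra.
have tp : 0 < t by rewrite lt0r tn.
have := mulr_gt0 tp (_ : 0 < b - v); rewrite subr_gt0 => /(_ vb) h'.
by lra.
Qed.

Lemma convex_connected (A : set (R * R)) :
  (forall x y, A x -> A y -> segment x y `<=` A) -> connected A.
Proof.
move=> cvxA; have [->|/set0P[x Ax]] := eqVneq A set0; first exact: connected0.
have -> : A = \bigcup_(y in A) segment x y.
  apply/seteqP; split=> [y Ay|z [y Ay]]; last exact: cvxA.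
  by exists y => //; apply: segment_r.
apply: bigcup_connected => [|y _]; last exact: connected_segment.
by exists x => y _; apply: segment_l.
Qed.

Lemma continuous_polar p (th : R) : continuous (fun z : R * R => polar p z.1 (th + z.2)).
Proof.
have cs : continuous (fun z : R * R => th + z.2).
  by move=> z; apply: cvgD; [exact: cvg_cst|exact: continuous_coord2].
have cc : continuous (fun z : R * R => cos (th + z.2)).
  move=> z; apply: (@continuous_comp _ _ _ (fun z : R * R => th + z.2) cos).
    exact: cs.
  exact: continuous_cos.
have cn : continuous (fun z : R * R => sin (th + z.2)).
  move=> z; apply: (@continuous_comp _ _ _ (fun z : R * R => th + z.2) sin).
    exact: cs.
  exact: continuous_sin.
apply: continuous_pair => z; apply: cvgD; try exact: cvg_cst.
  by apply: cvgM; [exact: continuous_coord1|exact: cc].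
by apply: cvgM; [exact: continuous_coord1|exact: cn].
Qed.

(** Provides test points close to an edge: the bound on [cos e] is what puts a point at radius 1/4
    and angle [e] within squared distance 3/16 of the midpoint. *)
Lemma exists_small_angle (g : R) : 0 < g ->
  exists e : R, [/\ 0 < e, e < g, e < pi, 1 / 2 < cos e & 0 < sin e].
Proof.
move=> g0; have : \forall e \near (0 : R), 1 / 2 < cos e.
  have h : 1 / 2 < cos (0 : R) by rewrite cos0; lra.
  exact: (cvgr_gt (cos 0) (@continuous_cos R 0) (1 / 2) h).
move=> /nbhs_ballP[d /= d0 hd].
pose e := Num.min (d / 2) (Num.min (g / 2) 1).
have e0 : 0 < e by rewrite !lt_min ltr01 andbT; apply/andP; split; rewrite divr_gt0.
have e1 : e <= 1 by rewrite !ge_min lexx !orbT.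
have eg : e <= g / 2 by rewrite !ge_min lexx !orbT.
have ed : e <= d / 2 by rewrite !ge_min lexx.
have := pi_ge2 R => pi2.
exists e; split; [by []|lra|lra| |].
  by apply: hd; rewrite /ball /= sub0r normrN gtr0_norm //; lra.
by apply: sin_gt0_pi; apply/andP; split; lra.
Qed.

End Polar.

Section Sectors.
Variables (R : realType) (c : nat -> R * R).
Hypothesis sep : forall i j, i != j -> 1 <= dsq (c i) (c j).
Hypothesis conn : connected_graph (unit_distance c).
Notation adj := (unit_distance c).
Notation graph := (penny_embedding c).

Definition theta i j : R := angle (c i) (c j).

Lemma theta_itv i j : 0 <= theta i j < 2 * pi.
Proof. exact: angle_itv. Qed.

Lemma theta_polar i j : adj i j -> c j = polar (c i) 1 (theta i j).
Proof.
by move=> ij; rewrite [LHS](angle_polar (c i)) adj_dsq // sqrtr1.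
Qed.

Lemma theta_inj i j k : adj i j -> adj i k -> theta i j = theta i k -> j = k.
Proof.
move=> /theta_polar ij /theta_polar ik E; apply/eqP; apply: contraT => /sep.
by rewrite ij ik E dsqpp lt_geF.
Qed.

Lemma segment_polar i j x : adj i j -> segment (c i) (c j) x ->
  exists2 r, 0 <= r & x = polar (c i) r (theta i j).
Proof.
move=> /theta_polar cj [t /=]; rewrite in_itv /= => /andP[t0 t1] <-.
exists t => //; rewrite cj /polar /=; congr pair; ring.
Qed.

Lemma polar_segment i j (r : R) : adj i j -> 0 <= r <= 1 ->
  segment (c i) (c j) (polar (c i) r (theta i j)).
Proof.
move=> /theta_polar cj r01; exists r; first by rewrite /= in_itv.
rewrite cj /polar /=; congr pair; ring.
Qed.

(* The open sector of the disk of radius 1/2 about [c i] that lies immediately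
   counterclockwise of the edge from [i] to [k]. *)
Definition sector i k : set (R * R) :=
  [set polar (c i) z.1 (theta i k + z.2) | z in
    [set z : R * R | 0 < z.1 < 1 / 2 /\
       (0 < z.2 /\ forall l, adj i l -> z.2 < ccw (theta i k) (theta i l))]].

(** The set of polar coordinates is convex, and the sector is its continuous image. *)
Lemma sector_connected i k : connected (sector i k).
Proof.
apply: connected_continuous_connected.
  apply: convex_connected => z w [/andP[z1 z1'] [z2 z3]] [/andP[w1 w1'] [w2 w3]].
  move=> _ [t /= + <-]; rewrite in_itv /= => /andP[t0 t1].
  have cvx u v a b := @conv_lt R t u v a b t0 t1.
  have a1 := cvx _ _ _ _ z1 w1; have a2 := cvx _ _ _ _ z1' w1'.
  have a3 := cvx _ _ _ _ z2 w2.
  split; first by apply/andP; split; lra.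
  split; first by lra.
  by move=> l /[dup] /z3 h1 /w3 h2; have := cvx _ _ _ _ h1 h2; lra.
by apply: continuous_subspaceT => z; apply: continuous_polar.
Qed.

Lemma sector_disk i k : sector i k `<=` disk (c i) 2^-1.
Proof.
move=> _ [z [/andP[z1 z1'] _] <-]; rewrite /disk /= edist_lt ?invr_gt0 // dsq_polar.
by rewrite ltr_pXn2r // ?nnegrE ?invr_ge0 ?ltW //; lra.
Qed.

(** Inside the disk the graph consists of radii along the edges at [i], and the angles of the sector
    stop before the next such edge. *)
Lemma sector_complement i k : adj i k -> sector i k `<=` ~` graph.
Proof.
move=> ik x sx gx; have dx := sector_disk sx.
have [l il sl] := disk_graph sep conn dx gx.
case: sx => z [/andP[z1 z1'] [z2 z3]] zx.
have [r r0 xr] := segment_polar il sl.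
rewrite -zx in xr; have := z3 l il.
have /andP[a1 a2] := theta_itv i k; have /andP[b1 b2] := theta_itv i l.
move=> zl; have h : `|theta i k + z.2 - theta i l| < 2 * pi.
  by move: zl; rewrite /ccw ltr_norml; case: (ltP (theta i k)) => h hl; apply/andP; split; lra.
have := polar_inj z1 r0 h xr.
by move: zl; rewrite /ccw; case: (ltP (theta i k)) => h1 hl; lra.
Qed.

(** The edge to [k] is the first one met when turning clockwise from [x] about [c i]. *)
Lemma disk_sector i x : disk (c i) 2^-1 x -> ~ graph x ->
  exists2 k, adj i k & sector i k x.
Proof.
rewrite /disk /= edist_lt ?invr_gt0 // => dx ngx.
have [t [/andP[t0 t1] xE]] := exists_polar (c i) x.
set r := Num.sqrt _ in xE.
have r1 : r < 1 / 2.
  rewrite /r -(ger0_norm (_ : 0 <= 1 / 2)) // -sqrtr_sqr ltr_sqrt; last by lra.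
  by rewrite mul1r.
have r0 : 0 < r.
  rewrite lt0r sqrtr_ge0 andbT; apply: contra_not_neq ngx => r0.
  by left; exists i => //; rewrite xE r0 /polar !mul0r !addr0; case: (c i).
have tn k : adj i k -> t != theta i k.
  move=> ik; apply: contra_not_neq ngx => tk; apply/(graphP conn).
  exists i, k; split=> //; rewrite xE tk; apply: polar_segment => //.
  by rewrite ltW //=; lra.
have nn : nbrs sep i != [::].
  have [j ij] := exists_nbr conn i; apply/eqP => n0.
  by have := mem_nbrs sep i j; rewrite ij n0.
have [k] := exists_argmin (fun k => ccw (theta i k) t) nn.
rewrite mem_nbrs // => ik kmin; exists k => //.
exists (r, ccw (theta i k) t) => /=.
  split; first by rewrite r0.
  have /andP[a1 a2] := theta_itv i k.
  have tk := tn k ik.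
  split; first by rewrite /ccw; case: (ltP (theta i k)) => h; lra.
  move=> l il; have := kmin l; rewrite mem_nbrs // => /(_ il).
  have /andP[b1 b2] := theta_itv i l.
  have := tn _ il; have := tn _ ik; rewrite !neq_lt.
  rewrite /ccw; case: (ltP (theta i l) t); case: (ltP (theta i k) t) => h1 h2;
    case: (ltP (theta i k) (theta i l)) => h3; lra.
rewrite xE /ccw; case: (ltP (theta i k)) => h; last rewrite addrA polarD2pi.
  by rewrite addrC subrK.
by rewrite addrC subrK.
Qed.

(* Turning left at the end [j] of the dart [(i, j)] means leaving along the edge
   that precedes [(j, i)] counterclockwise. *)
Definition next_head (d : nat * nat) : set nat :=
  [set k | adj d.2 k /\ forall l, adj d.2 l ->
     ccw (theta d.2 k) (theta d.2 d.1) <= ccw (theta d.2 l) (theta d.2 d.1)].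

Definition next_dart (d : nat * nat) : nat * nat := (d.2, xget 0%N (next_head d)).

Lemma next_dartP d : next_head d (next_dart d).2.
Proof.
have nn : nbrs sep d.2 != [::].
  have [j ij] := exists_nbr conn d.2; apply/eqP => n0.
  by have := mem_nbrs sep d.2 j; rewrite ij n0.
have [k] := exists_argmin (fun k => ccw (theta d.2 k) (theta d.2 d.1)) nn.
rewrite mem_nbrs // => dk kmin; apply: (@xgetPex _ 0%N (next_head d)).
exists k; split=> // l dl.
by apply: kmin; rewrite mem_nbrs.
Qed.

Lemma next_dartPair i j : let k := (next_dart (i, j)).2 in
  adj j k /\ forall l, adj j l -> ccw (theta j k) (theta j i) <= ccw (theta j l) (theta j i).
Proof. exact: next_dartP (i, j). Qed.

Definition is_dart (d : nat * nat) := adj d.1 d.2.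

Lemma next_dart_is_dart d : is_dart (next_dart d).
Proof. by have [] := next_dartP d. Qed.

(** If two different tails at the same vertex had the same successor [k], the one met first
    counterclockwise from [k] would lie between [k] and the other, against the minimality of [k]. *)
Lemma next_dart_inj d e : is_dart d -> is_dart e -> next_dart d = next_dart e -> d = e.
Proof.
case: d e => [a j] [b j'] ja jb.
move=> E; have := next_dartPair a j; have := next_dartPair b j'.
rewrite -E; set k := (next_dart (a, j)).2.
have jj : j = j' := congr1 fst E.
subst j'; move=> [_ mb] [jk ma].
move: ja jb; rewrite /is_dart /= adjC => ja; rewrite adjC => jb.
congr pair; apply: (theta_inj ja jb).
have := ma _ jb; have := mb _ ja.
have /andP[] := theta_itv j a; have /andP[] := theta_itv j b; have /andP[] := theta_itv j k.
rewrite /ccw; case: (ltP (theta j k) (theta j a)) => h1; case: (ltP (theta j k) (theta j b)) => h2;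
  case: (ltP (theta j a) (theta j b)) => h3; case: (ltP (theta j b) (theta j a)) => h4; lra.
Qed.

(** Among the neighbours with [P], take the one nearest to [l] counterclockwise from [l]. Its
    predecessor also has [P] and would be nearer still, unless it is [l]. *)
Lemma rotation_transitive j (P : nat -> Prop) :
  (forall i, adj j i -> P i -> P (next_dart (i, j)).2) ->
  forall k, adj j k -> P k -> forall l, adj j l -> P l.
Proof.
move=> Pn k jk Pk l jl.
pose s := [seq i <- nbrs sep j | `[< P i >]].
have sP i : i \in s = adj j i && `[< P i >] by rewrite mem_filter mem_nbrs // andbC.
have s0 : s != [::].
  apply/eqP => s0; have := sP k; rewrite s0 jk.
  by have -> : `[< P k >] by apply/asboolP.
have [i] := exists_argmin (fun i => ccw (theta j l) (theta j i)) s0.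
rewrite sP => /andP[ji /asboolP Pi] imin.
have := next_dartPair i j; set m := (next_dart (i, j)).2 => -[jm mmin].
have Pm : P m by apply: Pn.
have h1 : ccw (theta j l) (theta j i) <= ccw (theta j l) (theta j m).
  by apply: imin; rewrite sP jm; apply/asboolP.
have h2 := mmin l jl.
have [<- //|ml] := eqVneq m l; exfalso; move: h1 h2.
have : theta j m != theta j l by apply: contra_neq ml; apply: theta_inj.
have /andP[] := theta_itv j m; have /andP[] := theta_itv j l; have /andP[] := theta_itv j i.
rewrite neq_lt /ccw; case: (ltP (theta j m) (theta j i)) => h1;
  case: (ltP (theta j l) (theta j i)) => h2;
  case: (ltP (theta j l) (theta j m)) => h3; lra.
Qed.

Definition half_disk i j : set (R * R) :=
  [set x | dsq (midp (c i) (c j)) x < 3 / 16 /\ 0 < cross (c i) (c j) x].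

Lemma half_disk_connected i j : connected (half_disk i j).
Proof.
apply: convex_connected => z w [z1 z2] [w1 w2] _ [t /= + <-].
rewrite in_itv /= => /andP[t0 t1]; split.
  rewrite dsq_segment; have := conv_lt t0 t1 z1 w1.
  have : 0 <= t * (1 - t) * dsq z w by rewrite !mulr_ge0 ?dsq_ge0 // subr_ge0.
  by lra.
have -> : cross (c i) (c j) ((1 - t) * z.1 + t * w.1, (1 - t) * z.2 + t * w.2) =
  (1 - t) * cross (c i) (c j) z + t * cross (c i) (c j) w by rewrite /cross /=; ring.
by have := conv_lt t0 t1 z2 w2; lra.
Qed.

Lemma cross_segment a b x : segment a b x -> cross a b x = 0 :> R.
Proof. by move=> [t _ <-]; rewrite /cross /=; ring. Qed.

Lemma half_disk_complement i j : adj i j -> half_disk i j `<=` ~` graph.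
Proof.
move=> ij x [x1 x2] /(graphP conn)[a [b [ab s]]].
have [[Ea Eb]|[Ea Eb]] := midp_graph sep ij ab x1 s; move: s x2; rewrite Ea Eb => /cross_segment.
  by move=> ->; rewrite ltxx.
by rewrite crossC => /eqP; rewrite oppr_eq0 => /eqP ->; rewrite ltxx.
Qed.

Lemma sector_gap i k : exists2 g : R, 0 < g &
  forall l, adj i l -> g <= ccw (theta i k) (theta i l).
Proof.
have nn : nbrs sep i != [::].
  have [j ij] := exists_nbr conn i; apply/eqP => n0.
  by have := mem_nbrs sep i j; rewrite ij n0.
have [l] := exists_argmin (fun l => ccw (theta i k) (theta i l)) nn.
rewrite mem_nbrs // => il lmin; exists (ccw (theta i k) (theta i l)).
  have /andP[] := theta_itv i k; have /andP[] := theta_itv i l.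
  by rewrite /ccw; case: (ltP (theta i k) (theta i l)) => h; lra.
by move=> m im; apply: lmin; rewrite mem_nbrs.
Qed.

(** The common point has radius 1/4 and a small angle [e] from the edge. By the law of cosines its
    squared distance to the midpoint is 5/16 - cos e / 4, and its [cross] is sin e / 4. *)
Lemma half_disk_sector_start i k : adj i k -> half_disk i k `&` sector i k !=set0.
Proof.
move=> ik; have [g g0 gl] := sector_gap i k.
have [e [e0 eg epi ce se]] := exists_small_angle g0.
exists (polar (c i) (1 / 4) (theta i k + e)); split; last first.
  exists (1 / 4, e) => //=; split; first by apply/andP; split; lra.
  by split=> // m im; apply: lt_le_trans eg _; apply: gl.
have := cos2Dsin2 (theta i k); have := cos2Dsin2 e.
rewrite /half_disk /= /cross /dsq /midp (theta_polar ik) /polar /= cosD sinD => h1 h2.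
split.
  apply: (@le_lt_trans _ _ (5 / 16 - cos e / 4)); last by lra.
  rewrite le_eqVlt; apply/orP; left; apply/eqP.
  transitivity ((cos (theta i k) ^+ 2 + sin (theta i k) ^+ 2) *
    (1 / 4 - cos e / 4 + (cos e ^+ 2 + sin e ^+ 2) / 16)); first by field.
  by rewrite h1 h2; field.
apply: (@lt_le_trans _ _ (sin e / 4)); first by lra.
rewrite le_eqVlt; apply/orP; left; apply/eqP.
transitivity ((cos (theta i k) ^+ 2 + sin (theta i k) ^+ 2) * sin e / 4).
  by rewrite h2; field.
by field.
Qed.

(** The mirror image at the head [j]: directions slightly clockwise of the edge back to [i] belong
    to the sector of the next dart. Together with the start of the edge this carries the left face
    through a turn. *)
Lemma half_disk_sector_end i j : adj i j ->
  half_disk i j `&` sector j (next_dart (i, j)).2 !=set0.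
Proof.
move=> ij; have ji : adj j i by rewrite adjC.
have := next_dartPair i j; set k := (next_dart (i, j)).2 => -[jk kmin].
have thi := theta_itv j i; have thk := theta_itv j k.
pose g := ccw (theta j k) (theta j i).
have g0 : 0 < g.
  by move: thi thk => /andP[? ?] /andP[? ?]; rewrite /g /ccw; case: (ltP (theta j k) (theta j i)) => h; lra.
have [e [e0 eg epi ce se]] := exists_small_angle g0.
exists (polar (c j) (1 / 4) (theta j k + (g - e))); split; last first.
  exists (1 / 4, g - e) => //=; split; first by apply/andP; split; lra.
  split=> [|m jm]; first by lra.
  have := kmin m jm; move: thi thk; have := theta_itv j m.
  move=> /andP[? ?] /andP[? ?] /andP[? ?]; rewrite /g /ccw.
  case: (ltP (theta j k) (theta j i)) => h1;
  case: (ltP (theta j m) (theta j i)) => h2;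
  case: (ltP (theta j k) (theta j m)) => h3; lra.
have -> : polar (c j) (1 / 4) (theta j k + (g - e)) =
          polar (c j) (1 / 4) (theta j i - e).
  rewrite /g /ccw; case: (ltP (theta j k)) => _; first by congr polar; ring.
  by rewrite -(polarD2pi _ _ (theta j i - e)); congr polar; ring.
have := cos2Dsin2 (theta j i); have := cos2Dsin2 e.
rewrite /half_disk /= /cross /dsq /midp (theta_polar ji) /polar /= cosB sinB => h1 h2.
split.
  apply: (@le_lt_trans _ _ (5 / 16 - cos e / 4)); last by lra.
  rewrite le_eqVlt; apply/orP; left; apply/eqP.
  transitivity ((cos (theta j i) ^+ 2 + sin (theta j i) ^+ 2) *
    (1 / 4 - cos e / 4 + (cos e ^+ 2 + sin e ^+ 2) / 16)); first by field.
  by rewrite h1 h2; field.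
apply: (@lt_le_trans _ _ (sin e / 4)); first by lra.
rewrite le_eqVlt; apply/orP; left; apply/eqP.
transitivity ((cos (theta j i) ^+ 2 + sin (theta j i) ^+ 2) * sin e / 4).
  by rewrite h2; field.
by field.
Qed.

End Sectors.

(** * The winding number of a union of face orbits *)

Lemma near_curve (R : realType) (f : R -> R * R) (U : set (R * R)) :
  {for 0, continuous f} -> nbhs (f 0) U ->
  exists2 d : R, 0 < d & forall e, 0 < e -> e < d -> U (f e).
Proof.
move=> fc fU; have /nbhs_ballP[d /= d0 hd] : nbhs 0 (f @^-1` U) by exact: fc.
exists d => // e e0 ed; apply: hd; rewrite /ball /= sub0r normrN gtr0_norm //.
Qed.

(** Displacement along the left normal of the vector from [a] to [b]. *)
Definition normal_shift (R : realType) (a b x : R * R) (e : R) : R * R :=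
  (x.1 + e * (a.2 - b.2), x.2 + e * (b.1 - a.1)).

Lemma normal_shift0 (R : realType) (a b x : R * R) : normal_shift a b x 0 = x.
Proof. by rewrite /normal_shift !mul0r !addr0 -surjective_pairing. Qed.

Lemma continuous_normal_shift (R : realType) (a b x : R * R) :
  continuous (normal_shift a b x).
Proof.
have aff (u v : R) : continuous (fun e : R => u + e * v).
  by move=> e; apply: cvgD; [exact: cvg_cst|apply: cvgM; [exact: cvg_id|exact: cvg_cst]].
by apply: continuous_pair; apply: aff.
Qed.

Lemma cross_normal_shift (R : realType) (a b x : R * R) e :
  cross a b (normal_shift a b x e) = cross a b x + e * dsq a b.
Proof. by rewrite /cross /normal_shift /dsq /=; ring. Qed.

Lemma cross_midp (R : realType) (a b : R * R) : cross a b (midp a b) = 0.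
Proof. by rewrite /cross /midp /=; field. Qed.

Section Faces.
Variables (R : realType) (c : nat -> R * R).
Hypothesis sep : forall i j, i != j -> 1 <= dsq (c i) (c j).
Hypothesis conn : connected_graph (unit_distance c).
Notation adj := (unit_distance c).
Notation graph := (penny_embedding c).
Notation is_dart := (is_dart c).
Notation next := (next_dart c).

(* The face to the left of a dart. *)
Definition face (d : nat * nat) : set (R * R) :=
  connected_component (~` graph) (xget (c 0%N) (half_disk c d.1 d.2)).

Lemma face_complement d : face d `<=` ~` graph.
Proof. exact: connected_component_sub. Qed.

Lemma half_disk_face d : is_dart d -> half_disk c d.1 d.2 `<=` face d.
Proof.
move=> dd; apply: connected_component_max.
- have [x [hx _]] := half_disk_sector_start sep conn dd.
  exact: (@xgetPex _ (c 0%N) (half_disk c d.1 d.2) (ex_intro _ x hx)).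
- exact: half_disk_complement.
- exact: half_disk_connected.
Qed.

Lemma face_absorb d (S : set (R * R)) : connected S -> S `<=` ~` graph ->
  S `&` face d !=set0 -> S `<=` face d.
Proof.
move=> cS SG [x [Sx fx]]; rewrite /face (same_connected_component fx).
exact: connected_component_max.
Qed.

Lemma sector_face d : is_dart d -> sector c d.1 d.2 `<=` face d.
Proof.
move=> dd; apply: face_absorb; first exact: sector_connected.
  exact: sector_complement.
have [x [hx sx]] := half_disk_sector_start sep conn dd.
by exists x; split=> //; apply: half_disk_face hx.
Qed.

Lemma face_nonempty d : is_dart d -> face d !=set0.
Proof.
move=> dd; have [x [hx _]] := half_disk_sector_start sep conn dd.
by exists x; apply: half_disk_face hx.
Qed.

Lemma face_eq d e x : face d x -> face e x -> face d = face e.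
Proof.
by move=> dx ex; rewrite /face (same_connected_component dx) (same_connected_component ex).
Qed.

Lemma face_component d x : face d x -> connected_component (~` graph) x = face d.
Proof. by move=> dx; rewrite /face (same_connected_component dx). Qed.

Lemma face_next d : is_dart d -> face (next d) = face d.
Proof.
case: d => i j dd; have [x [hx sx]] := half_disk_sector_end sep conn dd.
have nd := next_dart_is_dart sep conn (i, j).
by apply: (@face_eq _ _ x); [apply: (sector_face nd)|apply: half_disk_face hx].
Qed.

Lemma is_dart_rev i j : is_dart (i, j) = is_dart (j, i).
Proof. exact: adjC. Qed.

Section StableDarts.
Variable B : seq (nat * nat).
Hypotheses (uB : uniq B) (dB : forall d, d \in B -> is_dart d)
  (nB : forall d, d \in B -> next d \in B).

(** An injective map of a finite set into itself is a permutation. *)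
Lemma stable_perm : perm_eq (map next B) B.
Proof.
have un : uniq (map next B).
  by rewrite map_inj_in_uniq // => d e /dB dd /dB de; apply: next_dart_inj.
have sub : {subset map next B <= B} by move=> _ /mapP[d /nB dn ->].
have [|_ E] := uniq_min_size un sub; first by rewrite size_map.
exact: uniq_perm.
Qed.

(** The tail of [next d] is the head of [d], so permuting [B] by [next] turns heads into tails. *)
Lemma stable_balanced : balanced B.
Proof.
have := perm_map fst stable_perm; rewrite -map_comp perm_sym => h.
exact: h.
Qed.

Lemma stable_next d : is_dart d -> (next d \in B) = (d \in B).
Proof.
move=> dd; apply/idP/idP; last exact: nB.
rewrite -(perm_mem stable_perm) => /mapP[e eB E].
by rewrite (next_dart_inj sep conn dd (dB eB) E).
Qed.

Lemma winding_face d x y : face d x -> face d y -> winding c B x = winding c B y.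
Proof.
move=> dx dy.
have cf : connected (face d) by exact: component_connected.
pose P z := winding c B x = winding c B z.
suff lc : forall z, face d z -> \forall w \near z, face d w -> (P w <-> P z).
  exact: (connected_loc_const cf lc dx dy (erefl _)).
move=> z fz; have nz : ~ graph z := face_complement fz.
apply: filterS (winding_loc_const stable_balanced (x0 := z) _).
  by move=> w; rewrite /P => -> _.
move=> e /dB de; split; first exact: (adj_cneq de).
by move=> s; apply: nz; apply/(graphP conn); exists e.1, e.2.
Qed.

(** The midpoint is a limit of its translates along the left normal, which lie in the half disk. *)
Lemma near_half_disk i j (U : set (R * R)) : adj i j ->
  nbhs (midp (c i) (c j)) U -> exists2 x, half_disk c i j x & U x.
Proof.
move=> ij; set m := midp _ _ => mU.
have fU : nbhs (normal_shift (c i) (c j) m 0) U by rewrite normal_shift0.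
have [d d0 hd] := near_curve (@continuous_normal_shift _ (c i) (c j) m 0) fU.
have g0 : 0 < Num.min d (1 / 4) by rewrite lt_min d0; lra.
have [e [e0 ed _ _ _]] := exists_small_angle g0.
move: ed; rewrite lt_min => /andP[ed e4].
exists (normal_shift (c i) (c j) m e); last exact: hd.
have dij := adj_dsq ij; split.
  have -> : dsq m (normal_shift (c i) (c j) m e) = e ^+ 2 * dsq (c i) (c j).
    by rewrite /dsq /normal_shift /=; ring.
  by rewrite dij; nra.
by rewrite cross_normal_shift cross_midp add0r dij mulr1.
Qed.

Lemma winding_across i j x y : adj i j -> face (i, j) x -> face (j, i) y ->
  winding c B x - winding c B y = Posz ((i, j) \in B) - Posz ((j, i) \in B).
Proof.
move=> ij fx fy; have ji : adj j i by rewrite adjC.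
have [||K hK] := @winding_jump R _ c B i j stable_balanced uB (adj_cneq ij).
- by move=> d /dB dd; apply: (adj_cneq dd).
- move=> [a b] /dB ab n1 n2 s.
  have : dsq (midp (c i) (c j)) (midp (c i) (c j)) < 3 / 16 by rewrite dsqpp; lra.
  move=> /(midp_graph sep ij ab) /(_ s) [E|E].
    by move: n1; rewrite E eqxx.
  by move: n2; rewrite E eqxx.
have [x' hx' [/(_ (proj2 hx')) wx _]] := near_half_disk ij hK.
rewrite midpC in hK; have [y' hy' [_ wy]] := near_half_disk ji hK.
rewrite (winding_face fx (half_disk_face (d := (i, j)) ij hx')) wx.
rewrite (winding_face fy (half_disk_face (d := (j, i)) ji hy')) wy.
  by rewrite addrC addKr.
by have [_] := hy'; rewrite crossC oppr_gt0.
Qed.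

(** The invariant that is propagated over the graph. The winding number is constant on a face, so
    the chosen point does not matter. *)
Definition defect (d : nat * nat) : int :=
  winding c B (xget (c 0%N) (face d)) - Posz (d \in B).

Lemma defectE d x : face d x -> defect d = winding c B x - Posz (d \in B).
Proof.
move=> fx; congr (_ - _); apply: (@winding_face d) => //.
exact: (@xgetPex _ (c 0%N) (face d) (ex_intro _ x fx)).
Qed.

Lemma defect_next d : is_dart d -> defect (next d) = defect d.
Proof.
move=> dd; have [x fx] := face_nonempty dd.
by rewrite (defectE fx) (@defectE _ x) ?face_next // stable_next.
Qed.

Lemma defect_rev i j : adj i j -> defect (j, i) = defect (i, j).
Proof.
move=> ij; have ji : adj j i by rewrite adjC.
have [x fx] := @face_nonempty (i, j) ij; have [y fy] := @face_nonempty (j, i) ji.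
rewrite (defectE fx) (defectE fy).
by apply/eqP; rewrite -subr_eq0; have := winding_across ij fx fy; lia.
Qed.

(** Reversing [(j, i)] and then turning left gives the next dart out of [j] in clockwise order, so
    these two moves reach all darts out of [j]. *)
Lemma defect_vertex (g : int) j k : adj j k -> defect (j, k) = g ->
  forall l, adj j l -> defect (j, l) = g.
Proof.
move=> jk; apply: (rotation_transitive sep conn (P := fun l => defect (j, l) = g)) => // i ji.
rewrite -(defect_rev ji) => <-; apply: (@defect_next (i, j)).
by rewrite is_dart_rev.
Qed.

Lemma defect_const d e : is_dart d -> is_dart e -> defect d = defect e.
Proof.
case: d e => [i k] [j l] ik jl.
suff H s : path adj i s -> forall l, adj (last i s) l -> defect (i, k) = defect (last i s, l).
  have [n' [p' [pp' E _]]] := conn i j.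
  by have := H p' pp' l; rewrite E; apply.
elim/last_ind: s => [_|s v IH]; first by move=> m im; apply/esym/(defect_vertex ik).
rewrite rcons_path last_rcons => /andP[ps sv] m vm.
apply/esym/(@defect_vertex _ _ (last i s)) => //; first by rewrite adjC.
by rewrite -defect_rev ?(IH ps _ sv) // adjC.
Qed.

Lemma seq_in_box p (l : seq nat) : exists K : nat, forall i, i \in l -> in_box c p K%:R i.
Proof.
elim: l => [|a l [K hK]]; first by exists 0%N.
pose u := `|(c a).1 - p.1| + `|(c a).2 - p.2|.
have ub : u < (Num.truncn u).+1%:R by apply: truncnS_gt; rewrite addr_ge0.
exists (maxn K (Num.truncn u).+1) => i; rewrite in_cons => /orP[/eqP ->|/hK /andP[h1 h2]].
  have h : (Num.truncn u).+1%:R <= (maxn K (Num.truncn u).+1)%:R :> R.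
    by rewrite ler_nat leq_maxr.
  have h1 := normr_ge0 ((c a).1 - p.1); have h2 := normr_ge0 ((c a).2 - p.2).
  by move: ub; rewrite /u => ub; apply/andP; split; lra.
have h : K%:R <= (maxn K (Num.truncn u).+1)%:R :> R by rewrite ler_nat leq_maxl.
by apply/andP; split; [apply: le_trans h1 h|apply: le_trans h2 h].
Qed.

(* The defect vanishes far away from [B], hence everywhere. *)
Lemma defect0 d : is_dart d -> defect d = 0.
Proof.
move=> dd; have [K hK] := seq_in_box (c 0%N) (map fst B).
(* The extra 1 leaves room for a test point within 1/2 of [c i], which must still be outside the box
   of radius [K] around the tails of [B]. *)
have [i ni] := exists_far sep (c 0%N) K.+1.
have [j ij] := exists_nbr conn i.
rewrite (@defect_const d (i, j)) //.
have [x [hx sx]] := half_disk_sector_start sep conn ij.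
rewrite (@defectE _ x); last exact: (half_disk_face (d := (i, j)) ij hx).
have hB e : e \in B -> `|(c e.1).1 - (c 0%N).1| <= K%:R /\ `|(c e.1).2 - (c 0%N).2| <= K%:R.
  by move=> eB; apply/andP; apply: hK; apply: map_f.
have -> : (i, j) \in B = false.
  apply/negbTE; apply: contra ni => /hB [h1 h2]; rewrite /in_box -natr1.
  by apply/andP; split; lra.
rewrite subr0; apply/eqP; apply: contraT => w.
have [h1 h2] := winding_far stable_balanced hB w.
have := sector_disk sx; rewrite /disk /= edist_lt ?invr_gt0 // => dx.
have [|h3 h4] := @dsq_le_coord R (c i) x (2^-1) _ (ltW dx); first by rewrite invr_ge0.
case/negP: ni; rewrite /in_box -natr1.
by apply/andP; split; [move: h1 h3|move: h2 h4]; rewrite !ler_norml =>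
  /andP[? ?] /andP[? ?]; apply/andP; split; lra.
Qed.

Lemma winding_indicator d x : is_dart d -> face d x ->
  winding c B x = Posz (d \in B).
Proof. by move=> dd fx; apply/eqP; rewrite -subr_eq0 -(defectE fx) defect0. Qed.

End StableDarts.
End Faces.

(** * Bounded faces *)

Section BoundedFaces.
Variables (R : realType) (c : nat -> R * R).
Hypothesis sep : forall i j, i != j -> 1 <= dsq (c i) (c j).
Hypothesis conn : connected_graph (unit_distance c).
Notation adj := (unit_distance c).
Notation graph := (penny_embedding c).
Notation is_dart := (is_dart c).
Notation next := (next_dart c).
Notation face := (face c).

(** The form in which bounded facial degree is used: [D] bounds the number of distinct vertices
    whose disks meet a face. *)
Variable D : nat.
Hypothesis faceD : forall d, is_dart d -> forall l : seq nat, uniq l ->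
  (forall i, i \in l -> face d `&` disk (c i) 2^-1 !=set0) -> (size l <= D)%N.

(** Bounds the darts with a given left face: at most [D] tails, each with at most 25 neighbours. *)
Let N := (25 * D)%N.

Lemma iter_next d m : is_dart d ->
  [/\ is_dart (iter m next d), face (iter m next d) = face d &
      walk adj d.1 (iter m next d).1 m].
Proof.
move=> dd; elim: m => [|m [IH1 IH2 IH3]] /=; first by split=> //; exists [::].
split; first exact: next_dart_is_dart.
  by rewrite face_next.
by rewrite -addn1; apply: walk_cat IH3 _; apply: walk1.
Qed.

(** Otherwise the first N + 1 darts of the orbit would be distinct, although all of them have the
    same left face. *)
Lemma orbit_looping d : is_dart d -> looping next d N.
Proof.
move=> dd; apply: contraT; rewrite -looping_uniq => ut.
set t := traject next d N.+1 in ut.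
have tP e : e \in t -> is_dart e /\ face e = face d.
  by move=> /trajectP[m _ ->]; have [] := iter_next m dd.
pose l := undup (map fst t).
have lD : (size l <= D)%N.
  apply: (faceD dd); first exact: undup_uniq.
  move=> i; rewrite mem_undup => /mapP[e /tP [de <-] ->].
  have [x [_ sx]] := half_disk_sector_start sep conn de.
  by exists x; split; [apply: (sector_face sep conn de)|apply: sector_disk sx].
have : (size t <= size [seq (i, j) | i <- l, j <- nbrs sep i])%N.
  apply: uniq_leq_size => // e et; apply/allpairsPdep.
  exists e.1, e.2; split; last by case: (e).
    by rewrite mem_undup map_f.
  by rewrite mem_nbrs; have [] := tP e et.
rewrite size_traject size_allpairs_dep leqNgt => /negP; case.
rewrite ltnS /N mulnC; apply: leq_trans (leq_mul lD (leqnn 25)).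
elim: (l) => //= i s IH; rewrite mulSn leq_add //; exact: nbrs_size.
Qed.

Definition orbit_seq d := undup (traject next d N).

Lemma mem_orbit d e : is_dart d -> e \in orbit_seq d ->
  is_dart e /\ exists2 m, (m <= N)%N & walk adj d.1 e.1 m.
Proof.
move=> dd; rewrite mem_undup => /trajectP[m mN ->].
by have [h1 _ h2] := iter_next m dd; split=> //; exists m => //; apply: ltnW.
Qed.

Lemma orbit_next d e : is_dart d -> e \in orbit_seq d -> next e \in orbit_seq d.
Proof.
move=> dd; rewrite !mem_undup => /trajectP[m mN ->].
by rewrite -iterS; apply/loopingP/orbit_looping.
Qed.

Lemma orbit_self d : is_dart d -> d \in orbit_seq d.
Proof. by move=> dd; rewrite mem_undup; have /loopingP/(_ 0%N) := orbit_looping dd. Qed.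

Lemma orbit_winding d e x : is_dart d -> is_dart e -> face e x ->
  winding c (orbit_seq d) x = Posz (e \in orbit_seq d).
Proof.
move=> dd de fx; apply: (@winding_indicator R c sep conn _ _ _ _ e) => //.
- exact: undup_uniq.
- by move=> ? /(mem_orbit dd)[].
- by move=> ?; apply: orbit_next.
Qed.

(** The orbit of [d] winds once around the points of its own face. As this is also the face of [e],
    the dart [e] belongs to the orbit. *)
Lemma face_walk d e : is_dart d -> is_dart e -> face d = face e ->
  exists2 m, (m <= N)%N & walk adj d.1 e.1 m.
Proof.
move=> dd de E; have [x fx] := face_nonempty sep conn dd.
have := orbit_winding dd dd fx; rewrite orbit_self //.
rewrite (orbit_winding dd de); last by rewrite -E.
by case: (boolP (e \in orbit_seq d)) => // /(mem_orbit dd)[].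
Qed.

(** The orbit has nonzero winding number at [x], so [x] lies in any box containing the orbit. *)
Lemma face_near d x : is_dart d -> face d x ->
  `|x.1 - (c d.1).1| <= N%:R /\ `|x.2 - (c d.1).2| <= N%:R.
Proof.
move=> dd fx; apply: (@winding_far R _ c (orbit_seq d)).
- apply: (stable_balanced sep conn); first exact: undup_uniq.
    by move=> ? /(mem_orbit dd)[].
  by move=> ?; apply: orbit_next.
- move=> e /(mem_orbit dd)[_ [m mN /walk_coord[h1 h2]]].
  have h : m%:R <= N%:R :> R by rewrite ler_nat.
  by rewrite !(distrC (c e.1).1) !(distrC (c e.1).2); split; [apply: le_trans h1 h|apply: le_trans h2 h].
- by rewrite (orbit_winding dd dd fx) orbit_self.
Qed.

Lemma mid_disk_half i j x : adj i j -> dsq (midp (c i) (c j)) x < 3 / 16 ->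
  ~ graph x -> half_disk c i j x \/ half_disk c j i x.
Proof.
move=> ij mx ngx; have [h|h|h] := ltgtP (cross (c i) (c j) x) 0.
- by right; split; [rewrite midpC|rewrite crossC oppr_gt0].
- by left.
exfalso; apply: ngx; apply/(graphP conn); exists i, j; split=> //.
have dij := adj_dsq ij; move: dij h mx; rewrite /dsq /cross /midp /=.
set a1 := (c i).1; set a2 := (c i).2; set b1 := (c j).1; set b2 := (c j).2.
move=> dij h mx.
(* The coordinate of [x] along the edge. Since [cross] vanishes, [x] is the point with parameter
   [t], and (t - 1/2)^2 < 3/16 puts [t] in [0, 1]. *)
pose t := (b1 - a1) * (x.1 - a1) + (b2 - a2) * (x.2 - a2).
have e1 : x.1 - a1 = t * (b1 - a1).
  have -> : x.1 - a1 = (x.1 - a1) * ((a1 - b1) ^+ 2 + (a2 - b2) ^+ 2) by rewrite dij mulr1.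
  apply/eqP; rewrite -subr_eq0; apply/eqP.
  transitivity (- (b2 - a2) * ((b1 - a1) * (x.2 - a2) - (b2 - a2) * (x.1 - a1))).
    by rewrite /t; ring.
  by rewrite h mulr0.
have e2 : x.2 - a2 = t * (b2 - a2).
  have -> : x.2 - a2 = (x.2 - a2) * ((a1 - b1) ^+ 2 + (a2 - b2) ^+ 2) by rewrite dij mulr1.
  apply/eqP; rewrite -subr_eq0; apply/eqP.
  transitivity ((b1 - a1) * ((b1 - a1) * (x.2 - a2) - (b2 - a2) * (x.1 - a1))).
    by rewrite /t; ring.
  by rewrite h mulr0.
have tt : (t - 1 / 2) ^+ 2 < 3 / 16.
  clearbody t; apply: le_lt_trans mx; rewrite -[X in X <= _]mulr1 -[X in _ * X <= _]dij.
  have -> : x.1 = a1 + t * (b1 - a1) by rewrite -e1; ring.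
  have -> : x.2 = a2 + t * (b2 - a2) by rewrite -e2; ring.
  by rewrite le_eqVlt; apply/orP; left; apply/eqP; field.
exists t; first by rewrite /= in_itv /=; apply/andP; split; nra.
rewrite [RHS]surjective_pairing -/a1 -/a2 -/b1 -/b2; congr pair.
  by transitivity (a1 + t * (b1 - a1)); [ring|rewrite -e1; ring].
by transitivity (a2 + t * (b2 - a2)); [ring|rewrite -e2; ring].
Qed.

(** The complement is open, and balls are convex, so the segments from [x] to nearby points avoid
    the graph. *)
Lemma near_component (x : R * R) : ~ graph x ->
  \forall y \near x, connected_component (~` graph) x y.
Proof.
move=> ngx; have := open_complement sep conn; rewrite openE => /(_ x ngx).
rewrite /interior => /nbhs_ballP[d /= d0 hd].
apply/nbhs_ballP; exists d => //= y [y1 y2].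
apply: (@connected_component_max _ (~` graph) (segment x y)); first exact: segment_l.
- move=> _ [t /= + <-]; rewrite in_itv /= => /andP[t0 t1]; apply: hd.
  have sub u v : `|u - v| < d -> `|u - ((1 - t) * u + t * v)| < d.
    have -> : u - ((1 - t) * u + t * v) = t * (u - v) by ring.
    by rewrite normrM (ger0_norm t0) => h; apply: le_lt_trans h; rewrite ler_piMl.
  by split; rewrite /ball /=; apply: sub.
- exact: connected_segment.
- exact: segment_r.
Qed.

(* Near a point of the complement there is only its face, near a vertex only
   sectors at that vertex, near a midpoint only the two sides of the edge. *)
Lemma near_faces (x : R * R) : ~ graph x \/
  (exists i j, is_dart (i, j) /\ \forall y \near x, ~ graph y ->
     exists2 d, is_dart d & face d y /\ (d.1 = i \/ d = (j, i))).
Proof.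
case: (pselect (graph x)) => [gx|]; [right|by left].
have [[i dx]|[i [j [ij mx]]]] := graph_cover conn gx.
  have [j ij] := exists_nbr conn i; exists i, j; split=> //.
  have : \forall y \near x, disk (c i) 2^-1 y.
    move: dx; rewrite /disk /= edist_lt ?invr_gt0 // => /near_dsq.
    by apply: filterS => y; rewrite /disk /= edist_lt ?invr_gt0.
  apply: filterS => y dy ngy; have [k ik sk] := disk_sector sep conn dy ngy.
  by exists (i, k) => //; split; [apply: (sector_face sep conn (d := (i, k)))|left].
exists i, j; split=> //; apply: filterS (near_dsq mx) => y my ngy.
have ji : adj j i by rewrite adjC.
have [h|h] := mid_disk_half ij my ngy.
  by exists (i, j) => //; split; [apply: (half_disk_face sep conn (d := (i, j)))|left].
by exists (j, i) => //; split; [apply: (half_disk_face sep conn (d := (j, i)))|right].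
Qed.

(** A component of the complement that is no left face of a dart would stay away from the graph,
    near which every complement point lies in such a face. It would then be open and closed, hence
    the whole plane. *)
Lemma face_exists x : ~ graph x -> exists2 d, is_dart d & face d x.
Proof.
move=> ngx; apply: contrapT => nd.
pose P z := connected_component (~` graph) x z.
have lc : forall z, [set: R * R] z -> \forall w \near z, [set: R * R] w -> (P w <-> P z).
  move=> z _; have [ngz|[i [j [ij h]]]] := near_faces z.
    apply: filterS (near_component ngz) => w zw _; split=> h.
      by apply: connected_component_trans h _; apply: connected_component_sym.
    exact: connected_component_trans h zw.
  have nP : \forall w \near z, ~ P w.
    apply: filterS h => w hw Pw; apply: nd.
    have [|d dd [fw _]] := hw; first exact: connected_component_sub Pw.
    exists d => //; rewrite -(face_component fw).
    exact: connected_component_sym.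
  have nPz : ~ P z := nbhs_singleton nP.
  by apply: filterS nP => w nPw _; split.
have cT : connected [set: R * R] by apply: convex_connected.
have : P (c 0%N).
  apply: (connected_loc_const cT lc (x := x)) => //.
  exact: connected_component_refl.
by move=> /connected_component_sub; apply; left; exists 0%N.
Qed.

Lemma complement_dense (x : R * R) (U : set (R * R)) : nbhs x U -> exists2 y, U y & ~ graph y.
Proof.
move=> xU; case: (pselect (graph x)) => [gx|ngx]; last first.
  by exists x => //; apply: nbhs_singleton.
have [[i dx]|[i [j [ij mx]]]] := graph_cover conn gx.
  have [j ij sj] := disk_graph sep conn dx gx.
  have [r r0 xr] := segment_polar ij sj.
  have r2 : r < 1 / 2.
    move: dx; rewrite /disk /= edist_lt ?invr_gt0 // xr dsq_polar.
    by rewrite ltr_pXn2r // ?nnegrE ?invr_ge0 //; lra.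
  (* Radius and angle grow together, so that the curve leaves the graph even from the vertex itself,
     where [r] is 0. *)
  pose f (e : R) := polar (c i) (r + e) (theta c i j + e).
  have fc : {for 0, continuous f}.
    apply: (@continuous_comp _ _ _ (fun e : R => (r + e, e))
      (fun z : R * R => polar (c i) z.1 (theta c i j + z.2))).
      apply: continuous_pair => e; last exact: cvg_id.
      by apply: cvgD; [exact: cvg_cst|exact: cvg_id].
    exact: continuous_polar.
  have fU : nbhs (f 0) U by rewrite /f !addr0 -xr.
  have [d d0 hd] := near_curve fc fU.
  have [g g0 gl] := sector_gap sep conn i j.
  have m0 : 0 < Num.min d (Num.min g (1 / 2 - r)).
    by rewrite !lt_min d0 g0 subr_gt0.
  have [e [e0 + _ _ _]] := exists_small_angle m0.
  rewrite !lt_min => /and3P[ed eg er].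
  exists (f e); first exact: hd.
  apply: (sector_complement sep conn ij); exists (r + e, e) => //=.
  split; first by apply/andP; split; lra.
  by split=> // l il; apply: lt_le_trans eg (gl l il).
have /graphP := gx; move=> /(_ conn) [a [b [ab s]]].
have cr : cross (c i) (c j) x = 0.
  have [[Ea Eb]|[Ea Eb]] := midp_graph sep ij ab mx s; move: s; rewrite Ea Eb => /cross_segment //.
  by rewrite crossC => /eqP; rewrite oppr_eq0 => /eqP.
have fU : nbhs (normal_shift (c i) (c j) x 0)
    (U `&` [set y | dsq (midp (c i) (c j)) y < 3 / 16]).
  by rewrite normal_shift0; apply: filterI xU (near_dsq mx).
have [d d0 hd] := near_curve (@continuous_normal_shift _ (c i) (c j) x 0) fU.
have [fe1 fe2] : (U `&` [set y | dsq (midp (c i) (c j)) y < 3 / 16])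
    (normal_shift (c i) (c j) x (d / 2)) by apply: hd; lra.
exists (normal_shift (c i) (c j) x (d / 2)) => //.
apply: (half_disk_complement sep conn ij); split=> //.
by rewrite cross_normal_shift cr adj_dsq //; lra.
Qed.

(** [N] covers the distance from a complement point to a tail of its face, and 1 the move from [x]
    to such a point. *)
Lemma vertex_near (x : R * R) : exists i, `|(c i).1 - x.1| <= N.+1%:R /\ `|(c i).2 - x.2| <= N.+1%:R.
Proof.
have n1 : nbhs x [set y | dsq x y < 1] by apply: near_dsq; rewrite dsqpp.
have [y /= xy ngy] := complement_dense n1.
have [d dd fy] := face_exists ngy; exists d.1.
have [h1 h2] := face_near dd fy.
have [|h3 h4] := @dsq_le_coord R x y 1 ler01; first by rewrite expr1n ltW.
by rewrite -natr1; split; [move: h1 h3|move: h2 h4]; rewrite !ler_norml =>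
  /andP[? ?] /andP[? ?]; apply/andP; split; lra.
Qed.

(** Walks of length at most [N] join the tails of darts with the same face; the other side of an
    edge costs one more step. *)
Lemma near_faces_walk (x : R * R) : exists v, \forall y \near x, ~ graph y ->
  forall d, is_dart d -> face d y -> exists2 m, (m <= N.+1)%N & walk adj d.1 v m.
Proof.
have [ngx|[i [j [ij h]]]] := near_faces x.
  have [e de fe] := face_exists ngx; exists e.1.
  apply: filterS (near_component ngx) => y xy ngy d dd fd.
  have [|m mN w] := face_walk dd de; last by exists m => //; apply: leqW.
  apply: (face_eq fd); rewrite -(face_component fe); exact: xy.
exists i; apply: filterS h => y hy ngy d dd fd.
have [e de [fe ei]] := hy ngy.
have [m mN w] := face_walk dd de (face_eq fd fe).
case: ei => [E|E]; first by exists m; rewrite -?E //; apply: leqW.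
exists (m + 1)%N; first by rewrite addn1.
by apply: walk_cat w _; rewrite E; apply: walk1; rewrite adjC.
Qed.

End BoundedFaces.

(** * Graph distance is bounded in terms of Euclidean distance *)

Section CoarseDistance.
Variables (R : realType) (c : nat -> R * R).
Hypothesis sep : forall i j, i != j -> 1 <= dsq (c i) (c j).
Hypothesis conn : connected_graph (unit_distance c).
Notation adj := (unit_distance c).
Notation graph := (penny_embedding c).
Notation is_dart := (is_dart c).
Notation face := (face c).

Variable D : nat.
Hypothesis faceD : forall d, is_dart d -> forall l : seq nat, uniq l ->
  (forall i, i \in l -> face d `&` disk (c i) 2^-1 !=set0) -> (size l <= D)%N.

Let N := (25 * D)%N.

Lemma near_box (x y z : R * R) (a b : R) :
  `|x.1 - y.1| <= a -> `|x.2 - y.2| <= a -> `|y.1 - z.1| <= b -> `|y.2 - z.2| <= b ->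
  `|x.1 - z.1| <= a + b /\ `|x.2 - z.2| <= a + b.
Proof.
move=> h1 h2 h3 h4.
by split; apply: le_trans (ler_distD _ _ _) (lerD _ _); first [exact: h1|exact: h2|idtac].
Qed.

Lemma face_vertex_near d (x y : R * R) : is_dart d -> face d y -> dsq x y < 1 ->
  `|(c d.1).1 - x.1| <= N.+1%:R /\ `|(c d.1).2 - x.2| <= N.+1%:R.
Proof.
move=> dd fy xy; have [h1 h2] := face_near sep conn faceD dd fy.
have [|h3 h4] := @dsq_le_coord R x y 1 ler01; first by rewrite expr1n ltW.
by rewrite -natr1; apply: (@near_box _ y); rewrite // distrC.
Qed.

Section Reach.
Variables (i : nat) (K : nat).
(** The radius is (K + N + 1) + (N + 1): vertices at faces near the segment lie within K + N + 1 of
    [c i], and the walks between them have length at most N + 1. *)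
Let W : seq nat := box_seq sep (c i) (K + (2 * N + 2)).

Definition reach j := exists2 p, path adj i p & last i p = j /\ {subset p <= W}.

Lemma reach_step a b : adj a b -> b \in W -> reach a -> reach b.
Proof.
move=> ab bW [p pp [pa pW]]; exists (rcons p b); first by rewrite rcons_path pp pa.
split; first by rewrite last_rcons.
by move=> k; rewrite mem_rcons in_cons => /orP[/eqP ->|/pW].
Qed.

Lemma reach_path a p : path adj a p -> a \in W -> {subset p <= W} ->
  (reach a <-> reach (last a p)).
Proof.
elim: p a => [|b p IH] a //= /andP[ab bp] aW pW.
have bW : b \in W by apply: pW; rewrite mem_head.
have <- := IH b bp bW (fun k kp => pW k (mem_behead (s := b :: p) kp)).
by split; apply: reach_step => //; rewrite adjC.
Qed.

(** After removal of loops, the path visits distinct vertices of the finite box. *)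
Lemma reach_size j : reach j -> exists2 m, (m <= size W)%N & walk adj i j m.
Proof.
move=> [p pp [<- pW]].
pose e := [rel a b | adj a b && (b \in W)].
have restrict a q : path adj a q -> {subset q <= W} -> path e a q.
  elim: q a => // b q IH a /andP[ab bq] qW; apply/andP; split.
    by apply/andP; split; [exact: ab|apply: qW; rewrite mem_head].
  by apply: IH => // k kq; apply: qW; rewrite in_cons kq orbT.
have inW a q : path e a q -> {subset q <= W}.
  elim: q a => // b q IH a /andP[/andP[_ bW] bq] k.
  by rewrite in_cons => /orP[/eqP ->//|]; apply: IH bq _.
case/shortenP: (restrict _ _ pp pW) => q qp uq _; exists (size q).
  by apply: uniq_leq_size; [case/andP: uq|apply: inW qp].
by exists q; split=> //; apply: sub_path qp => a b /andP[].
Qed.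

Lemma walk_reach a v m : walk adj a v m -> (m <= N.+1)%N ->
  in_box c (c i) (K + N.+1)%:R a -> (reach a <-> reach v).
Proof.
move=> [p [pp <- pm]] mN /andP[a1 a2].
have inW k : k \in a :: p -> k \in W.
  move=> kp; rewrite mem_box_seq.
  have [n nm w] : exists2 n, (n <= N.+1)%N & walk adj a k n.
    exists (index k (a :: p)).
      by rewrite -ltnS; apply: leq_trans (_ : size (a :: p) <= _)%N; rewrite ?index_mem //= pm ltnS.
    exists (take (index k (a :: p)) p); split.
    - by move: pp; rewrite -{1}(cat_take_drop (index k (a :: p)) p) cat_path => /andP[].
    - rewrite (last_nth a) size_takel; last first.
        by rewrite -ltnS -[(size p).+1]/(size (a :: p)) index_mem.
      by rewrite -[a :: take _ p]/(take (index k (a :: p)).+1 (a :: p)) nth_take // nth_index.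
    - by rewrite size_takel // -ltnS -[(size p).+1]/(size (a :: p)) index_mem.
  have [w1 w2] := walk_coord w.
  have nN : n%:R <= N.+1%:R :> R by rewrite ler_nat.
  have E : (K + (2 * N + 2))%:R = N.+1%:R + (K + N.+1)%:R :> R.
    by rewrite -natrD; congr _%:R; lia.
  rewrite /in_box E; apply/andP; apply: (@near_box _ (c a)) => //.
    by rewrite distrC; apply: le_trans w1 nN.
  by rewrite distrC; apply: le_trans w2 nN.
apply: reach_path => //; first by apply: inW; rewrite mem_head.
by move=> k kp; apply: inW; rewrite in_cons kp orbT.
Qed.

(** Extends [reach] from vertices to points of the plane, so that it can be propagated along a
    segment. *)
Definition reach_near (x : R * R) := \forall y \near x, ~ graph y ->
  forall d, is_dart d -> face d y -> reach d.1.

(** The tails of the darts with faces near [x] are joined to one vertex by walks inside [W], so all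
    of them are reachable or none is. *)
Lemma reach_near_dichotomy (x : R * R) :
  `|x.1 - (c i).1| <= K%:R -> `|x.2 - (c i).2| <= K%:R ->
  reach_near x \/ \forall y \near x, ~ graph y ->
    forall d, is_dart d -> face d y -> ~ reach d.1.
Proof.
move=> x1 x2; have [v hv] := near_faces_walk sep conn faceD x.
have n1 : \forall y \near x, dsq x y < 1 by apply: near_dsq; rewrite dsqpp.
have H : \forall y \near x, ~ graph y ->
    forall d, is_dart d -> face d y -> (reach d.1 <-> reach v).
  apply: filterS2 hv n1 => y hy xy ngy d dd fd.
  have [m mN w] := hy ngy d dd fd; apply: (walk_reach w mN).
  have [h1 h2] := face_vertex_near dd fd xy.
  by rewrite /in_box addnC natrD; apply/andP; apply: (near_box h1 h2).
have [rv|nrv] := pselect (reach v); [left|right];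
  by apply: filterS H => y hy ngy d dd fd; rewrite (hy ngy d dd fd).
Qed.

Lemma reach_near_vertex j : reach_near (c j) -> reach j.
Proof.
move=> rj; have nd : nbhs (c j) (disk (c j) 2^-1).
  have h : dsq (c j) (c j) < 2^-1 ^+ 2 by rewrite dsqpp exprn_gt0 // invr_gt0.
  by apply: filterS (near_dsq h) => y; rewrite /disk /= edist_lt ?invr_gt0.
have [y [ry dy] ngy] := complement_dense sep conn (filterI rj nd).
have [k jk sk] := disk_sector sep conn dy ngy.
exact: (ry ngy (j, k) jk (sector_face sep conn (d := (j, k)) jk sk)).
Qed.

Lemma reach_near_self : reach_near (c i).
Proof.
have [||//|nr] := @reach_near_dichotomy (c i); rewrite ?subrr ?normr0 //.
exfalso; have nd : nbhs (c i) (disk (c i) 2^-1).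
  have h : dsq (c i) (c i) < 2^-1 ^+ 2 by rewrite dsqpp exprn_gt0 // invr_gt0.
  by apply: filterS (near_dsq h) => y; rewrite /disk /= edist_lt ?invr_gt0.
have [y [ry dy] ngy] := complement_dense sep conn (filterI nr nd).
have [k ik sk] := disk_sector sep conn dy ngy.
apply: (ry ngy (i, k) ik (sector_face sep conn (d := (i, k)) ik sk)).
by exists [::].
Qed.

Lemma reach_box j : in_box c (c i) K%:R j -> reach j.
Proof.
move=> /andP[j1 j2]; apply: reach_near_vertex.
have lc z : segment (c i) (c j) z -> \forall w \near z, segment (c i) (c j) w ->
    (reach_near w <-> reach_near z).
  move=> [t /= + zE]; rewrite in_itv /= => /andP[t0 t1].
  have sub u v : `|v - u| <= K%:R -> `|(1 - t) * u + t * v - u| <= K%:R.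
    have -> : (1 - t) * u + t * v - u = t * (v - u) by ring.
    by rewrite normrM (ger0_norm t0) => h; apply: le_trans h; rewrite ler_piMl.
  have [||rz|nrz] := @reach_near_dichotomy z.
  - by rewrite -zE; apply: sub.
  - by rewrite -zE; apply: sub.
  - by apply: filterS (near_join rz) => w rw _.
  (* The two alternatives exclude each other: complement points are dense, and each lies in the face
     of a dart. *)
  - have nr w : (\forall y \near w, ~ graph y -> forall d, is_dart d -> face d y -> ~ reach d.1) ->
        ~ reach_near w.
      move=> nw rw; have [y [ny ry] ngy] := complement_dense sep conn (filterI nw rw).
      have [d dd fd] := face_exists sep conn ngy.
      exact: (ny ngy d dd fd (ry ngy d dd fd)).
    have nnz := nr z nrz.
    by apply: filterS (near_join nrz) => w /nr nw _.
have cs : connected (segment (c i) (c j)) by exact: connected_segment.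
have sl : segment (c i) (c j) (c i) by exact: segment_l.
have sr : segment (c i) (c j) (c j) by exact: segment_r.
exact: (@connected_loc_const _ _ reach_near _ _ cs lc sl sr reach_near_self).
Qed.

End Reach.
Lemma bounded_walk (K : nat) : exists M : nat, forall i j, in_box c (c i) K%:R j ->
  exists2 m, (m <= M)%N & walk adj i j m.
Proof.
exists ((4 * (K + (2 * N + 2)) + 1) ^ 2)%N => i j /reach_box /reach_size [m mW w].
by exists m => //; apply: leq_trans mW (box_seq_size _ _ _).
Qed.

(** The segment is cut into [n] steps of size at most 1 in each coordinate, with a vertex near each
    division point. Consecutive vertices are within 2 (N + 1) + 1 in each coordinate, so each step
    costs a bounded walk. *)
Lemma walk_le_dist : exists M : nat, forall i j n,
  in_box c (c i) n%:R j -> exists2 m, (m <= M * n.+1)%N & walk adj i j m.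
Proof.
have [M hM] := bounded_walk (2 * N.+1 + 1); exists M.
suff H n : forall (y z : R * R) i j, in_box c y N.+1%:R i -> in_box c z N.+1%:R j ->
    `|y.1 - z.1| <= n%:R -> `|y.2 - z.2| <= n%:R ->
    exists2 m, (m <= M * n.+1)%N & walk adj i j m.
  move=> i j n /andP[h1 h2]; apply: (H n (c i) (c j)); rewrite /in_box ?subrr ?normr0 ?ler0n //.
    by rewrite distrC.
  by rewrite distrC.
elim: n => [|n IH] y z i j /andP[i1 i2] /andP[j1 j2] d1 d2.
  rewrite muln1; apply: hM; rewrite /in_box.
  have -> : (2 * N.+1 + 1)%:R = N.+1%:R + (0 + N.+1%:R) + 1 :> R.
    by rewrite add0r -natrD natr1; congr _%:R; lia.
  have [h1 h2] : `|z.1 - (c i).1| <= 0 + N.+1%:R /\ `|z.2 - (c i).2| <= 0 + N.+1%:R.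
    by apply: (@near_box z y) => //; rewrite distrC.
  have [h3 h4] := near_box j1 j2 h1 h2.
  by apply/andP; split; rewrite (le_trans (_ : _ <= N.+1%:R + (0 + N.+1%:R))) // lerDl ler01.
(* One step from [z] towards [y], leaving at most [n] in each coordinate. *)
pose z' := lerp z y (n.+1%:R^-1).
have n0 : (0 : R) < n.+1%:R by rewrite ltr0n.
have part (u v : R) : `|u - v| <= n.+1%:R -> let w := (1 - n.+1%:R^-1) * v + n.+1%:R^-1 * u in
    `|u - w| <= n%:R /\ `|w - v| <= 1.
  move=> uv w; split.
    have -> : u - w = (1 - n.+1%:R^-1) * (u - v) by rewrite /w; ring.
    have iv : (0 : R) <= 1 - n.+1%:R^-1 by rewrite subr_ge0 invf_le1 // ler1n.
    rewrite normrM (ger0_norm iv); apply: le_trans (ler_wpM2l iv uv) _.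
    by rewrite mulrBl mul1r mulVf ?lt0r_neq0 // -natr1 addrK.
  have -> : w - v = n.+1%:R^-1 * (u - v) by rewrite /w; ring.
  have iv : (0 : R) <= n.+1%:R^-1 by rewrite invr_ge0 ltW.
  by rewrite normrM (ger0_norm iv) [X in X <= _]mulrC ler_pdivrMr // mul1r.
have [a1 b1] := part _ _ d1; have [a2 b2] := part _ _ d2.
have [k [k1 k2]] := vertex_near sep conn faceD z'.
have [m mM wm] := IH y z' i k (introT andP (conj i1 i2)) (introT andP (conj k1 k2)) a1 a2.
have [|m' mM' wm'] := hM k j.
  have -> : (2 * N.+1 + 1)%:R = N.+1%:R + 1 + N.+1%:R :> R.
    by rewrite natr1 -natrD; congr _%:R; lia.
  have [h1 h2] : `|(c j).1 - z'.1| <= N.+1%:R + 1 /\ `|(c j).2 - z'.2| <= N.+1%:R + 1.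
    by apply: (near_box j1 j2); rewrite distrC.
  by apply/andP; apply: (near_box h1 h2); rewrite distrC.
exists (m + m')%N; last exact: walk_cat wm wm'.
by rewrite mulnS addnC leq_add.
Qed.

End CoarseDistance.

(** * Quasi-isometry with the lattice *)

Section Corners.
Variables (R : realType) (c : nat -> R * R).

(** Each listed vertex gives at least one corner, the component through a chosen point of its trace;
    corners at different vertices differ in their first entry. *)
Lemma face_degree_ge (s : set (R * R)) (l : seq nat) : uniq l ->
  (forall i, i \in l -> s `&` disk (c i) 2^-1 !=set0) ->
  ((size l)%:R%:E <= face_degree c s)%E.
Proof.
move=> ul hl; rewrite /face_degree /counting; case: asboolP => [fin|_]; last exact: leey.
rewrite lee_fin ler_nat.
pose A i := s `&` disk (c i) 2^-1.
pose f i := (i, connected_component (A i) (xget (c i) (A i))).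
have -> : size l = size (map f l) by rewrite size_map.
apply: uniq_leq_size; first by rewrite map_inj_uniq // => i j [].
move=> _ /mapP[i /hl [x Ax] ->]; rewrite in_fset_set // inE /corners /components /f /=.
by exists (xget (c i) (A i)) => //; apply: (@xgetPex _ (c i) (A i)); exists x.
Qed.

Lemma face_degree_bounded :
  (ereal_sup [set face_degree c s | s in penny_faces c] < +oo)%E ->
  exists D : nat, forall s, penny_faces c s -> forall l : seq nat, uniq l ->
    (forall i, i \in l -> s `&` disk (c i) 2^-1 !=set0) -> (size l <= D)%N.
Proof.
set S := ereal_sup _ => Sfin.
have [D hD] : exists D : nat, (S <= D%:R%:E)%E.
  (* The last case, a supremum equal to -oo, is that of an empty family of faces. *)
  case: S Sfin => [r _|//|_]; last by exists 0%N; rewrite leNye.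
  exists (Num.truncn `|r|).+1; rewrite lee_fin; apply: le_trans (ler_norm r) _.
  by apply: ltW; apply: truncnS_gt.
exists D => s fs l ul hl; rewrite -(ler_nat R) -lee_fin.
apply: le_trans (face_degree_ge ul hl) _; apply: le_trans hD.
by apply: ereal_sup_ubound; exists s.
Qed.

End Corners.

Section Lattice.
Variable R : realType.
Notation lattice_adj := (unit_distance (@lattice_point R)).

Lemma lattice_walk_dir (u v : int) (n : nat) (w : int * int) :
  `|u| + `|v| = 1 -> walk lattice_adj w (w.1 + u * n%:Z, w.2 + v * n%:Z) n.
Proof.
move=> uv; elim: n => [|n IH].
  by exists [::]; split=> //=; rewrite !mulr0 !addr0 -surjective_pairing.
rewrite -addn1; apply: walk_cat IH _; apply: walk1.
rewrite adjE /dsq /lattice_point /= -!intrB -!rmorphXn -rmorphD /=.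
have -> : (w.1 + u * n - (w.1 + u * (n + 1)%N)) ^+ 2 + (w.2 + v * n - (w.2 + v * (n + 1)%N)) ^+ 2 = 1.
  have -> : w.1 + u * n - (w.1 + u * (n + 1)%N) = - u by rewrite PoszD; ring.
  have -> : w.2 + v * n - (w.2 + v * (n + 1)%N) = - v by rewrite PoszD; ring.
  by rewrite !expr2; nia.
by [].
Qed.

Lemma lattice_walk (w z : int * int) :
  walk lattice_adj w z (`|z.1 - w.1| + `|z.2 - w.2|)%N.
Proof.
(* A sign that takes the value 1 at 0, so that the direction of each leg is a unit vector. *)
have sg (u : int) : exists2 e : int, `|e| = 1 & u = e * (`|u|%N)%:Z.
  by case: (leP 0 u) => h; [exists 1|exists (-1)]; rewrite ?normrN ?normr1 //; lia.
have [e1 n1 h1] := sg (z.1 - w.1); have [e2 n2 h2] := sg (z.2 - w.2).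
apply: (@walk_cat _ _ _ _ (z.1, w.2)).
  have := @lattice_walk_dir e1 0 `|z.1 - w.1|%N w.
  by rewrite -h1 mul0r !addr0 [w.1 + _]addrC subrK; apply.
have := @lattice_walk_dir 0 e2 `|z.2 - w.2|%N (z.1, w.2).
by rewrite /= -h2 mul0r addr0 [w.2 + _]addrC subrK normr0 add0r [in X in _ -> X](surjective_pairing z); apply.
Qed.

Lemma lattice_dist_ge (w z : int * int) (d := graph_dist lattice_adj w z) :
  `|w.1%:~R - z.1%:~R : R| <= d%:R /\ `|w.2%:~R - z.2%:~R : R| <= d%:R.
Proof. exact: (walk_coord (graph_dist_walk (lattice_walk w z))). Qed.

Lemma lattice_dist_le (w z : int * int) (r : R) :
  `|w.1%:~R - z.1%:~R| <= r -> `|w.2%:~R - z.2%:~R| <= r ->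
  (graph_dist lattice_adj w z)%:R <= 2 * r.
Proof.
move=> h1 h2; have := graph_dist_le (lattice_walk w z).
rewrite -(ler_nat R) natrD => /le_trans; apply.
have E (a b : int) : `|a - b|%N%:R = `|b%:~R - a%:~R| :> R.
  by rewrite distrC -intrB -intr_norm -natr_absz.
by rewrite !E; lra.
Qed.

End Lattice.

Lemma floor_dist (R : realType) (x y : R) :
  `|(Num.floor x)%:~R - (Num.floor y)%:~R| <= `|x - y| + 1 /\
  `|x - y| <= `|(Num.floor x)%:~R - (Num.floor y)%:~R| + 1 :> R.
Proof.
have := floor_le x; have := floorD1_gt x; have := floor_le y; have := floorD1_gt y.
rewrite !intrD; set a : R := (Num.floor x)%:~R; set b : R := (Num.floor y)%:~R.
move=> h1 h2 h3 h4; split.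
  by have [h|h] := leP y x; have := ler_norm (x - y); have := ler_norm (y - x);
    rewrite (distrC y) ler_norml => ? ?; apply/andP; split; lra.
by have := ler_norm (a - b); have := ler_norm (b - a); rewrite (distrC b) ler_norml => ? ?;
  apply/andP; split; lra.
Qed.

Theorem theorem1p1 (R : realType) (c : nat -> plane R)
  (hpenny : penny_packing c)
  (hconn : connected_graph (unit_distance c))
  (hdeg : (ereal_sup [set face_degree c s | s in penny_faces c] < +oo)%E) :
  quasi_isometric
    (fun i j : nat => (graph_dist (unit_distance c) i j)%:R : R)
    (fun w z : int * int =>
       (graph_dist (unit_distance (@lattice_point R)) w z)%:R : R).
Proof.
have sep := penny_sep hpenny.
have [D hD] := face_degree_bounded hdeg.
have faceD d : is_dart c d -> forall l : seq nat, uniq l ->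
    (forall i, i \in l -> face c d `&` disk (c i) 2^-1 !=set0) -> (size l <= D)%N.
  move=> dd; apply: hD; have [x fx] := face_nonempty sep hconn dd.
  exists x; first exact: face_complement fx.
  exact: face_component.
have [M hM] := walk_le_dist sep hconn faceD.
set N : R := (25 * D)%N.+1%:R.
have vertex x : exists i, `|(c i).1 - x.1| <= N /\ `|(c i).2 - x.2| <= N.
  exact: (vertex_near sep hconn faceD x).
pose psi i := (Num.floor (c i).1, Num.floor (c i).2).
(* Generous choices for d <= M (dZ + 2), dZ <= 2 (d + 1) and 2 (N + 1) < C. *)
pose a : R := M%:R + 2; pose C : R := 2 * N + 10.
have N0 : 0 <= N by rewrite ler0n.
have M0 : 0 <= M%:R :> R by rewrite ler0n.
have a0 : 0 < a by rewrite /a; lra.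
exists psi, a, C; split; [by rewrite /a; lra|by rewrite /C; lra| |].
- move=> i j; set d : R := (graph_dist _ i j)%:R; set dZ : R := (graph_dist _ _ _)%:R.
  have d0 : 0 <= d by rewrite ler0n.
  have dZ0 : 0 <= dZ by rewrite ler0n.
  have [f1 g1] := floor_dist (c i).1 (c j).1; have [f2 g2] := floor_dist (c i).2 (c j).2.
  split.
  + have [z1 z2] : `|(psi i).1%:~R - (psi j).1%:~R| <= dZ /\ `|(psi i).2%:~R - (psi j).2%:~R| <= dZ.
      exact: lattice_dist_ge.
    (* Rounding down changes a difference of coordinates by at most 1, hence the successor. *)
    pose n := (graph_dist (unit_distance (@lattice_point R)) (psi i) (psi j)).+1.
    have nE : n%:R = dZ + 1 :> R by rewrite /n -natr1.
    have [|m mM /graph_dist_le w] := hM i j n.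
      rewrite /in_box nE !(distrC (c j).1) !(distrC (c j).2).
      by move: z1 z2; rewrite /psi /= => z1 z2; apply/andP; split; lra.
    have : d <= M%:R * (dZ + 2).
      have -> : M%:R * (dZ + 2) = (M * n.+1)%:R.
        by rewrite natrM -[n.+1%:R]natr1 nE -addrA.
      by rewrite ler_nat; apply: leq_trans w mM.
    move=> h; rewrite lerBlDr [X in X <= _]mulrC ler_pdivrMr //; apply: le_trans h _.
    by rewrite /a /C; nra.
  + have [w1 w2] : `|(c i).1 - (c j).1| <= d /\ `|(c i).2 - (c j).2| <= d.
      by have [n w] := hconn i j; apply: (walk_coord (graph_dist_walk w)).
    have : dZ <= 2 * (d + 1) by apply: lattice_dist_le; rewrite /psi /=; lra.
    by rewrite /a /C; nra.
- move=> y; have [i [i1 i2]] := vertex (lattice_point R y); exists i.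
  apply: (@le_lt_trans _ _ (2 * (N + 1))); last by rewrite /C; lra.
  have [f1 _] := floor_dist (c i).1 y.1%:~R; have [f2 _] := floor_dist (c i).2 y.2%:~R.
  move: f1 f2 i1 i2; rewrite !intrKfloor /lattice_point /= => f1 f2 i1 i2.
  by apply: lattice_dist_le; rewrite distrC /psi /=; lra.
Qed.
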